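(* Every $GL$-ideal of $K\langle X\rangle$ containing the polynomial $[x_1^2,x_2]$ is finitely generated as a $GL$-ideal.
   Context: $K$ is a fixed field of characteristic $0$. $K\langle X\rangle$ is the free associative algebra over $K$ on $X=\{x_1,x_2,\ldots\}$, and $\mathrm{sp}(X)$ is the vector subspace of $K\langle X\rangle$ spanned by $X$. $[a,b]=ab-ba$. For a subset $H=\{h_i(x_1,\ldots,x_{n_i})\mid i\in I\}$ of $K\langle X\rangle$, the $GL$-ideal generated by $H$ is the two-sided ideal of $K\langle X\rangle$ generated by all $h_i(\omega_1,\ldots,\omega_{n_i})$ with $i\in I$ and $\omega_j\in\mathrm{sp}(X)$. A $GL$-ideal is an ideal of this form, for some $H$; it is finitely generated as a $GL$-ideal if it is the $GL$-ideal generated by some finite set $H$. *)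

(* Defs.v *)
From mathcomp Require Import all_boot all_algebra.
From mathcomp Require Import monalg.
From mathcomp Require Import boolp classical_sets cardinality.

Set Implicit Arguments.
Unset Strict Implicit.
Unset Printing Implicit Defensive.

Import GRing.Theory.
Local Open Scope classical_set_scope.
Local Open Scope ring_scope.

(* The monoid algebra of the free monoid on nat, i.e. the free associative
   unital algebra on countably many generators. *)
Notation freeAlg K := {malg K[{fmonom nat}]}.

(* Indexing starts at 0: [gen K i] is the variable x_(i+1). *)
Definition gen (K : fieldType) (i : nat) : freeAlg K := << fmu i >>.

Definition spX (K : fieldType) : set (freeAlg K) :=
  [set w | exists (n : nat) (c : 'I_n -> K), w = \sum_(i < n) c i *: gen K i].

(* f(w 0, w 1, ...): a monomial is the sequence of its variables, so it is sent
   to the product, in order, of the corresponding w i. Only the w i for which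
   the i-th variable occurs in f matter. *)
Definition subst (K : fieldType) (w : nat -> freeAlg K) (f : freeAlg K) :
    freeAlg K :=
  mmap malgC (fun m : {fmonom nat} => \prod_(i <- (m : seq nat)) w i) f.

Definition commutator (R : nzRingType) (a b : R) : R := a * b - b * a.

(* Closure under opposite follows from closure under multiplication by -1. *)
Definition two_sided_ideal (R : nzRingType) (I : set R) : Prop :=
  [/\ I 0,
      forall a b, I a -> I b -> I (a + b)
    & forall a b, I b -> I (a * b) /\ I (b * a)].

Definition GL_ideal_gen (K : fieldType) (H : set (freeAlg K)) :
    set (freeAlg K) :=
  smallest (@two_sided_ideal (freeAlg K))
    [set g | exists (h : freeAlg K) (w : nat -> freeAlg K),
       [/\ H h, forall i, spX (w i) & g = subst w h]].

Definition GL_ideal (K : fieldType) (I : set (freeAlg K)) : Prop :=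
  exists H : set (freeAlg K), I = GL_ideal_gen H.

Definition fin_gen_GL_ideal (K : fieldType) (I : set (freeAlg K)) : Prop :=
  exists H : set (freeAlg K), finite_set H /\ I = GL_ideal_gen H.

(* Main.v *)
From HB Require Import structures.
Require Import Defs.
From mathcomp Require Import all_boot all_algebra.
From mathcomp Require Import finmap monalg.
From mathcomp Require Import zify.
From mathcomp Require Import ring.
From mathcomp Require Import boolp classical_sets cardinality.

Set Implicit Arguments.
Unset Strict Implicit.
Unset Printing Implicit Defensive.

Import GRing.Theory.
Local Open Scope ring_scope.

(* Write F for the free algebra modulo U, the GL-ideal of [x_1^2, x_2]; in F the
   square of every linear form is central.

   Modulo U and the images of the lowering derivations x_i |-> x_j (i < j), every
   word of multidegree mu is a multiple of x_1^mu_1 x_2^mu_2 ...: lowering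
   x^(s+2) g by x |-> y and using centrality moves the letters x to the front.
   In characteristic 0 the Casimir operator separates a highest weight vector of
   dominant weight mu from the lowering images, so a GL-ideal I containing U is
   determined by the set of partitions mu such that x^mu lies in I + (lowering
   images): take f in I of minimal multidegree outside a smaller GL-ideal J; its
   raised vectors lie in J, and f is a multiple of x^mu modulo lowering images.

   This set of partitions is stable under two operations. Inserting a row: place
   a power of a new variable at the end of x^mu and move it into position.
   Inserting a column of height k: multiply a highest weight vector by the
   Gram-Schmidt product of x_1, ..., x_k; the result is nonzero because its value
   at an orthonormal basis of a Clifford algebra is. In terms of boundary paths of
   partitions these are the insertions of a letter in a binary word, so by
   Higman's lemma the set is generated by finitely many partitions. *)

(** * Words, derivations and multidegrees *)

(** Background: F is the enveloping algebra of the free two-step nilpotent Lie superalgebra on an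
    odd space V, so it is the tensor product of the exterior algebra of V with S(S^2 V), and every
    irreducible polynomial GL-module occurs in it exactly once. None of this is assumed. The
    reduction of words gives [at most once], the Clifford sign functional gives [at least once], and
    the Casimir operator stands in for complete reducibility. The delicate point is that
    multiplication by a column vector might give 0 in F. A functional that is multiplicative up to
    sign on multihomogeneous elements excludes this. Containment of partitions is not the order that
    the two insertions give: (2,2) contains (2,1) but does not arise from it by inserting a row or a
    column. This is why boundary words and Higman's lemma appear in place of an argument on tuples
    of row lengths. *)

(* [{malg K[M]}] unfolds to finite maps, on which conversion is very slow; the
   argument is therefore carried out in an abstract algebra with a basis of words. *)
Record word_basis (K : fieldType) (A : algType K) := WordBasis {
  wmon : seq nat -> A;
  wext : forall V : lmodType K, (seq nat -> V) -> {linear A -> V};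
  wext_mon : forall (V : lmodType K) (h : seq nat -> V) u, wext h (wmon u) = h u;
  wbasis_ind : forall P : A -> Prop,
    P 0 -> (forall f c u, P f -> P (f + c *: wmon u)) -> forall f, P f;
  wmon1 : wmon [::] = 1;
  wmonM : forall u v, wmon u * wmon v = wmon (u ++ v) }.

Section FreeAlgebra.
Variables (K : fieldType) (A : algType K) (W : word_basis A).
Local Notation mon := (wmon W).

Lemma lin_ext (V : lmodType K) (F G : {linear A -> V}) :
  (forall u, F (mon u) = G (mon u)) -> F =1 G.
Proof.
move=> E; apply: (wbasis_ind (w := W)) => [|f c u IH]; first by rewrite !linear0.
by rewrite !linearD !linearZ /= E IH.
Qed.

Lemma mon_cons a u : mon (a :: u) = mon [:: a] * mon u.
Proof. by rewrite wmonM. Qed.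

(** A multidegree is represented by any word that has it: products become concatenation, and trading
    a letter j for i becomes [i :: rem j m]. *)
Definition hcomp (m : seq nat) : {linear A -> A} :=
  wext W (fun u => if perm_eq u m then mon u else 0).

Definition homog (m : seq nat) (f : A) := hcomp m f = f.

Lemma hcomp_mon m u : hcomp m (mon u) = if perm_eq u m then mon u else 0.
Proof. exact: wext_mon. Qed.

Lemma homog0 m : homog m 0.
Proof. exact: linear0. Qed.

Lemma homogD m f g : homog m f -> homog m g -> homog m (f + g).
Proof. by move=> Hf Hg; rewrite /homog linearD Hf Hg. Qed.

Lemma homogZ m c f : homog m f -> homog m (c *: f).
Proof. by move=> Hf; rewrite /homog linearZ /= Hf. Qed.

Lemma homogB m f g : homog m f -> homog m g -> homog m (f - g).
Proof. by move=> Hf Hg; rewrite /homog linearB /= Hf Hg. Qed.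

Lemma homog_mon m u : perm_eq u m -> homog m (mon u).
Proof. by move=> um; rewrite /homog hcomp_mon um. Qed.

Lemma homog_ind (m : seq nat) (P : A -> Prop) :
  P 0 -> (forall f c u, perm_eq u m -> P f -> P (f + c *: mon u)) ->
  forall f, homog m f -> P f.
Proof.
move=> P0 PD f <-; elim/(wbasis_ind (w := W)): f => [|f c u IH].
  by rewrite linear0.
rewrite linearD linearZ /= hcomp_mon; case: ifP => um; first exact: PD.
by rewrite scaler0 addr0.
Qed.

Lemma homog_perm m m' f : perm_eq m m' -> homog m f -> homog m' f.
Proof.
move=> mm'; elim/homog_ind => [|f' c u um IH]; first exact: homog0.
by apply/homogD/homogZ/homog_mon => //; apply: perm_trans um mm'.
Qed.

Lemma hcomp_homog m f : homog m (hcomp m f).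
Proof.
elim/(wbasis_ind (w := W)): f => [|f c u IH]; first by rewrite linear0; apply: homog0.
rewrite linearD linearZ /= hcomp_mon; apply: homogD => //.
by case: ifP => um; [apply/homogZ/homog_mon | rewrite scaler0; apply: homog0].
Qed.

Lemma homogM m1 m2 f g : homog m1 f -> homog m2 g -> homog (m1 ++ m2) (f * g).
Proof.
move=> Hf; elim/homog_ind => [|g' c v pv IH]; first by rewrite mulr0; apply: homog0.
rewrite mulrDr -scalerAr; apply/homogD/homogZ => // {IH g' g c}.
elim/homog_ind: Hf => [|f' c u pu IH]; first by rewrite mul0r; apply: homog0.
rewrite mulrDl -scalerAl wmonM; apply/homogD/homogZ/homog_mon => //.
exact: perm_cat.
Qed.

(* The derivation with [x_i |-> x_j] and [x_a |-> 0] for [a != i]. *)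
Fixpoint dword (i j : nat) (u : seq nat) : A :=
  if u is a :: u' then
    (if a == i then mon (j :: u') else 0) + mon [:: a] * dword i j u'
  else 0.

Definition der (i j : nat) : {linear A -> A} := wext W (dword i j).

Lemma der_mon i j u : der i j (mon u) = dword i j u.
Proof. exact: wext_mon. Qed.

Lemma der_cons i j a u :
  der i j (mon (a :: u)) =
  (if a == i then mon (j :: u) else 0) + mon [:: a] * der i j (mon u).
Proof. by rewrite !der_mon. Qed.

Lemma der1 i j : der i j 1 = 0.
Proof. by rewrite -(wmon1 W) der_mon. Qed.

Lemma derM i j f g : der i j (f * g) = der i j f * g + f * der i j g.
Proof.
elim/(wbasis_ind (w := W)): g => [|g c v IH].
  by rewrite mulr0 !linear0 !mulr0 addr0.
rewrite mulrDr !linearD /= IH mulrDr [in RHS]mulrDr addrACA; congr (_ + _).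
rewrite !linearZ /= -!scalerAr linearZ /= -scalerDr; congr (_ *: _) => {g c IH}.
elim/(wbasis_ind (w := W)): f => [|f c u IH]; first by rewrite mul0r !linear0 !mul0r addr0.
rewrite mulrDl !linearD /= IH mulrDl [in RHS]mulrDl addrACA; congr (_ + _).
rewrite -scalerAl !linearZ /= -!scalerAl -scalerDr wmonM; congr (_ *: _) => {f c IH}.
elim: u => [|a u IH]; first by rewrite (wmon1 W) der1 mul0r add0r mul1r.
rewrite cat_cons !der_cons IH mulrDr mulrDl !mulrA wmonM -addrA; congr (_ + _).
by case: eqP => _; rewrite ?mul0r // wmonM.
Qed.

Lemma der_gen i j a : der i j (mon [:: a]) = if a == i then mon [:: j] else 0.
Proof. by rewrite der_mon /= mulr0 addr0. Qed.

Lemma der_notin i j u : i \notin u -> der i j (mon u) = 0.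
Proof.
elim: u => [|a u IH]; first by rewrite (wmon1 W) der1.
rewrite inE negb_or eq_sym der_cons => /andP[/negPf -> /IH ->].
by rewrite mulr0 addr0.
Qed.

Lemma der_homog_notin i j m f : homog m f -> i \notin m -> der i j f = 0.
Proof.
move=> + im; elim/homog_ind => [|f' c u um IH]; first by rewrite linear0.
by rewrite linearD linearZ /= IH der_notin ?scaler0 ?addr0 // (perm_mem um).
Qed.

Lemma der_diag i u : der i i (mon u) = (count_mem i u)%:R *: mon u.
Proof.
elim: u => [|a u IH]; first by rewrite der_mon scale0r.
rewrite der_cons IH -scalerAr wmonM /= natrD scalerDl.
by case: eqP => [-> | _]; rewrite ?scale1r ?scale0r.
Qed.

Lemma der_homog i j m m' f :
  perm_eq (i :: m') (j :: m) -> homog m f -> homog m' (der i j f).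
Proof.
move=> pm; elim/homog_ind => [|f' c u pu IH].
  by rewrite linear0; apply: homog0.
rewrite linearD linearZ /=; apply/homogD/homogZ => // {f' c IH f}.
have {pu}pm : perm_eq (i :: m') (j :: u).
  by apply: perm_trans pm _; rewrite perm_cons perm_sym.
elim: u m' pm => [|a u IH] m' pm; first by rewrite (wmon1 W) der1; apply: homog0.
rewrite der_cons; apply: homogD.
  case: eqP => [ai | _]; last exact: homog0.
  by apply: homog_mon; apply/permP => P; move/permP/(_ P): pm; rewrite ai /=; lia.
have [iu | niu] := boolP (i \in u); last first.
  by rewrite der_notin // mulr0; apply: homog0.
have am' : perm_eq m' (a :: j :: rem i u).
  apply/permP => P; move/permP/(_ P): pm; move/permP/(_ P): (perm_to_rem iu) => /=.
  lia.
apply: (homog_perm (m := [:: a] ++ (j :: rem i u))); first by rewrite perm_sym.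
apply: homogM; first exact: homog_mon.
apply: IH.
by apply/permP => P; move/permP/(_ P): (perm_to_rem iu) => /=; lia.
Qed.

(** The relations of the matrix units of gl. A commutator of derivations is a derivation (the cross
    terms cancel in [AC8]), so the values on letters decide. *)
Lemma der_comm i j k l f :
  der i j (der k l f) - der k l (der i j f) =
  (i == l)%:R *: der k j f - (k == j)%:R *: der i l f.
Proof.
pose F : {linear A -> A} := (der i j \o der k l) \- (der k l \o der i j).
pose G : {linear A -> A} := ((i == l)%:R \*: der k j) \- ((k == j)%:R \*: der i l).
suff E u : F (mon u) = G (mon u) by exact: (lin_ext E f).
rewrite /F /G /=.
elim: u => [|a u IH].
  by rewrite (wmon1 W) !(der1, linear0, subrr).
have AC8 (V : zmodType) (p q r s p' s' : V) :
    p + q + (r + s) + (- (p' + r) - (q + s')) = p - p' + (s - s').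
  rewrite [X in X + _](AC (2*2) ((2*3)*(1*4))) -opprD.
  rewrite [X in _ - X](AC (2*2) ((3*2)*(1*4))).
  by rewrite opprD addrACA subrr add0r opprD addrACA.
rewrite mon_cons !derM !linearD /= !derM AC8 [RHS]addrACA -mulrBl -mulrBr IH.
rewrite mulrBr !scalerAr; congr (_ + _); rewrite -!scalerAr !scalerAl -mulrBl.
congr (_ * _); rewrite !der_gen.
rewrite (fun_if (der i j)) (fun_if (der k l)) !linear0 !der_gen.
rewrite (eq_sym i l) (eq_sym k j).
by do 4 case: (_ == _); rewrite ?scale1r ?scale0r ?subr0 ?scaler0.
Qed.
End FreeAlgebra.

(** * Ideals stable under linear substitutions *)

Section Stability.
Variables (K : fieldType) (A : algType K) (W : word_basis A).
Hypothesis K0 : forall n, n.+1%:R != 0 :> K.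
Local Notation mon := (wmon W).

Definition lin1 (w : A) :=
  exists (n : nat) (c : 'I_n -> K), w = \sum_(i < n) c i *: mon [:: val i].

Definition wsub (w : nat -> A) : {linear A -> A} :=
  wext W (fun u => \prod_(i <- u) w i).

Definition GL_stable (I : set A) :=
  two_sided_ideal I /\
  forall w, (forall i, lin1 (w i)) -> forall f, I f -> I (wsub w f).

Lemma lin1_sum n (c : nat -> K) : lin1 (\sum_(i < n) c i *: mon [:: val i]).
Proof. by exists n, (fun i => c i). Qed.

Lemma lin1P w : lin1 w <-> exists n (c : nat -> K), forall m, (n <= m)%N ->
  w = \sum_(i < m) c i *: mon [:: val i].
Proof.
split=> [[n [c ->]] | [n [c Hc]]]; last first.
  by rewrite (Hc n (leqnn n)); apply: lin1_sum.
exists n, (fun i => if insub i is Some j then c j else 0) => m le_nm.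
rewrite -(big_mkord xpredT (fun i =>
  (if insub i is Some j then c j else 0) *: mon [:: i])).
rewrite (big_cat_nat _ le_nm) //= [X in _ = _ + X]big_nat_cond [X in _ = _ + X]big1 ?addr0.
  rewrite big_mkord; apply: eq_bigr => i _; rewrite insubT //=.
  by move=> Hi; congr (c _ *: _); apply: val_inj.
move=> i /andP[/andP[ni _] _]; rewrite insubF ?scale0r //.
by apply/negbTE; rewrite -leqNgt.
Qed.

Lemma lin1D f g : lin1 f -> lin1 g -> lin1 (f + g).
Proof.
move=> /lin1P[n [c Hc]] /lin1P[m [d Hd]].
rewrite (Hc (n + m)%N) ?leq_addr // (Hd (n + m)%N) ?leq_addl //.
rewrite -big_split /=.
under eq_bigr do rewrite -scalerDl.
exact: (lin1_sum _ (fun i => c i + d i)).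
Qed.

Lemma lin1Z a f : lin1 f -> lin1 (a *: f).
Proof.
move=> [n [c ->]]; exists n, (fun i => a * c i).
by rewrite scaler_sumr; apply: eq_bigr => i _; rewrite scalerA.
Qed.

Lemma lin1_0 : lin1 0.
Proof. by exists 0, (fun _ => 0); rewrite big_ord0. Qed.

Lemma lin1_gen a : lin1 (mon [:: a]).
Proof.
exists a.+1, (fun i => (val i == a)%:R).
rewrite big_ord_recr /= eqxx scale1r big1 ?add0r // => i _.
by rewrite (ltn_eqF (ltn_ord i)) scale0r.
Qed.

Lemma wsub_mon w u : wsub w (mon u) = \prod_(i <- u) w i.
Proof. exact: wext_mon. Qed.

Lemma wsubM w f g : wsub w (f * g) = wsub w f * wsub w g.
Proof.
elim/(wbasis_ind (w := W)): g => [|g c v IH]; first by rewrite mulr0 linear0 mulr0.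
rewrite mulrDr linearD /= IH linearD /= [RHS]mulrDr; congr (_ + _).
rewrite -scalerAr !linearZ /= -scalerAr; congr (_ *: _) => {g c IH}.
elim/(wbasis_ind (w := W)): f => [|f c u IH]; first by rewrite mul0r linear0 mul0r.
rewrite mulrDl linearD /= IH linearD /= [RHS]mulrDl; congr (_ + _).
rewrite -scalerAl !linearZ /= -scalerAl; congr (_ *: _).
by rewrite wmonM !wsub_mon big_cat.
Qed.

Lemma wsub_lin1 w f : (forall i, lin1 (w i)) -> lin1 f -> lin1 (wsub w f).
Proof.
move=> Hw [n [c ->]]; rewrite linear_sum /=.
elim/big_ind: _ => [||i _]; [exact: lin1_0 | exact: lin1D |].
by rewrite linearZ /= wsub_mon big_seq1; apply: lin1Z.
Qed.

Lemma wsub_comp w w' f : wsub w (wsub w' f) = wsub (wsub w \o w') f.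
Proof.
elim/(wbasis_ind (w := W)): f => [|f c u IH]; first by rewrite !linear0.
rewrite linearD linearZ linearD linearZ /= IH linearD linearZ /= !wsub_mon.
congr (_ + _ *: _); elim: u => [|a u IHu]; last by rewrite !big_cons wsubM IHu.
by rewrite !big_nil -[in LHS](wmon1 W) wsub_mon big_nil.
Qed.

Section Ideal.
Variable I : set A.
Hypothesis idI : two_sided_ideal I.

Lemma idl0 : I 0. Proof. by case: idI. Qed.

Lemma idlD f g : I f -> I g -> I (f + g). Proof. by case: idI => _ H _; apply: H. Qed.

Lemma idlMl f g : I g -> I (f * g). Proof. by case: idI => _ _ H /(H f)[]. Qed.

Lemma idlMr f g : I f -> I (f * g). Proof. by case: idI => _ _ H /(H g)[]. Qed.

Lemma idlZ c f : I f -> I (c *: f).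
Proof. by rewrite -[f in c *: f]mul1r scalerAl; apply: idlMl. Qed.

Lemma idlN f : I f -> I (- f). Proof. by rewrite -scaleN1r; apply: idlZ. Qed.

Lemma idlB f g : I f -> I g -> I (f - g).
Proof. by move=> If Ig; apply/idlD/idlN. Qed.

Lemma idl_sum (T : Type) (r : seq T) (P : pred T) (F : T -> A) :
  (forall i, P i -> I (F i)) -> I (\sum_(i <- r | P i) F i).
Proof. by move=> H; apply: big_ind => //; [exact: idl0 | exact: idlD]. Qed.

Lemma idlZK c f : c != 0 -> I (c *: f) -> I f.
Proof. by move=> c0 /(idlZ c^-1); rewrite scalerA mulVf // scale1r. Qed.

(** Interpolation at t = 0, ..., n-1, which are distinct in characteristic 0: each coefficient is a
    combination of values, with coefficients from the inverse Vandermonde matrix. *)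
Lemma vandermonde_coef n (g : nat -> A) :
  (forall t : K, I (\sum_(r < n) t ^+ r *: g r)) -> forall r, (r < n)%N -> I (g r).
Proof.
move=> H r lt_rn; pose a : 'rV[K]_n := \row_j (val j)%:R.
have natr_inj (i j : 'I_n) : (val i)%:R = (val j)%:R :> K -> i = j.
  wlog le_ij : i j / (i <= j)%N => [Hw E|].
    by case/orP: (leq_total i j) => ?; [apply: Hw | apply/esym/Hw].
  move/esym/eqP; rewrite -subr_eq0 -natrB //= => /eqP E; apply: val_inj => /=.
  case D: (j - i)%N E => [|d] E; last by have := K0 d; rewrite E eqxx.
  by apply/eqP; rewrite eqn_leq le_ij -subn_eq0 D.
have unitV : Vandermonde n a \in unitmx.
  rewrite unitmxE det_Vandermonde unitfE; apply/prodf_neq0 => i _.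
  apply/prodf_neq0 => j lt_ij; rewrite !mxE subr_eq0.
  by apply/eqP => /natr_inj E; rewrite E ltnn in lt_ij.
pose V' := invmx (Vandermonde n a).
have -> : g r = \sum_(j < n) V' j (Ordinal lt_rn) *:
                 (\sum_(i < n) (val j)%:R ^+ i *: g i).
  under eq_bigr do rewrite scaler_sumr; rewrite exchange_big /=.
  have E (i : 'I_n) : \sum_(j < n) V' j (Ordinal lt_rn) *: ((val j)%:R ^+ i *: g i)
      = (i == Ordinal lt_rn)%:R *: g i.
    have /matrixP/(_ i (Ordinal lt_rn)) := mulmxV unitV.
    rewrite !mxE => <-; rewrite scaler_suml; apply: eq_bigr => j _.
    by rewrite scalerA !mxE mulrC.
  rewrite (eq_bigr _ (fun i _ => E i)) (bigD1 (Ordinal lt_rn)) //= eqxx scale1r.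
  by rewrite big1 ?addr0 // => i /negPf ->; rewrite scale0r.
by apply: idl_sum => j _; apply: idlZ.
Qed.
End Ideal.

Lemma wsub_preim_ideal I w : two_sided_ideal I ->
  two_sided_ideal (fun f => I (wsub w f)).
Proof.
move=> idI; split=> [|a b Ha Hb|a b Hb]; first by rewrite linear0; apply: idl0.
  by rewrite linearD; apply: idlD.
by rewrite !wsubM; split; [apply: idlMl | apply: idlMr].
Qed.

(* The coefficient of [t ^ r] in the image of a word under
   [x_i |-> p i + t q i]. *)
Fixpoint pcoef (p q : nat -> A) (r : nat) (u : seq nat) : A :=
  if u is a :: u' then
    p a * pcoef p q r u' + (if r is r'.+1 then q a * pcoef p q r' u' else 0)
  else (r == 0)%:R.

Lemma pcoef_big p q r u : (size u < r)%N -> pcoef p q r u = 0.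
Proof.
elim: u r => [|a u IH] [|r] //= lt_ur.
by rewrite !IH ?mulr0 ?addr0 // ltnW.
Qed.

Lemma prod_pcoef p q (t : K) n u : (size u < n)%N ->
  \prod_(i <- u) (p i + t *: q i) = \sum_(r < n) t ^+ r *: pcoef p q r u.
Proof.
elim: u n => [|a u IH] [|n] //= lt_un.
  rewrite big_nil big_ord_recl /= scale1r big1 ?addr0 // => i _.
  by rewrite scaler0.
rewrite big_cons mulrDl (IH n.+1 (leqW lt_un)).
under [RHS]eq_bigr do rewrite scalerDr.
rewrite big_split /=; congr (_ + _).
  by rewrite mulr_sumr; apply: eq_bigr => i _; rewrite scalerAr.
rewrite -(IH n.+1 (leqW lt_un)) (IH n lt_un) [RHS]big_ord_recl scaler0 add0r.
rewrite mulr_sumr; apply: eq_bigr => i _ /=.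
by rewrite -!scalerAl -scalerAr scalerA exprS.
Qed.

Lemma GL_pcoef I p q r f : GL_stable I ->
  (forall i, lin1 (p i)) -> (forall i, lin1 (q i)) ->
  I f -> I (wext W (pcoef p q r) f).
Proof.
move=> [idI subI] lp lq If.
(* The degree in t is bounded by the longest word of [f]. The bound comes with the vanishing of all
   later coefficients, and larger [m] are allowed so that it can grow in the induction. *)
have [n Hn] : exists n, forall m (t : K), (n <= m)%N ->
    (wsub (fun i => p i + t *: q i) f = \sum_(r < m) t ^+ r *: wext W (pcoef p q r) f)
    /\ ((m <= r)%N -> wext W (pcoef p q r) f = 0).
  elim/(wbasis_ind (w := W)): f {If} => [|f c u [n IH]].
    exists 0 => m t _; split; last by rewrite linear0.
    by rewrite linear0 big1 // => i _; rewrite linear0 scaler0.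
  exists (n + (size u).+1)%N => m t le_m.
  have [E1 E2] := IH m t (leq_trans (leq_addr _ _) le_m).
  have lt_um : (size u < m)%N by apply: leq_trans le_m; rewrite leq_addl.
  split=> [|le_mr].
    rewrite linearD linearZ /= E1 wsub_mon (prod_pcoef _ _ _ lt_um) scaler_sumr.
    rewrite -big_split /=; apply: eq_bigr => i _.
    by rewrite [in RHS]linearD [in RHS]linearZ /= wext_mon scalerDr !scalerA mulrC.
  rewrite linearD linearZ /= E2 // wext_mon pcoef_big ?scaler0 ?addr0 //.
  exact: leq_trans le_mr.
have [lt_rn | le_nr] := ltnP r n; last first.
  by have [_ ->//] := Hn n 0 (leqnn n); apply: idl0.
apply: (vandermonde_coef idI (g := fun r => wext W (pcoef p q r) f) _ lt_rn) => t.
by have [<- _] := Hn n t (leqnn n); apply: subI => // i; apply/lin1D/lin1Z.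
Qed.

(** The derivation is the coefficient of t in the substitution x_i |-> x_i + t x_j. *)
Lemma GL_der I i j f : GL_stable I -> I f -> I (der W i j f).
Proof.
move=> GLI If; pose q a := if a == i then mon [:: j] else 0.
have P0 u : pcoef (fun a => mon [:: a]) q 0 u = mon u.
  elim: u => [|a u IH] /=; first by rewrite (wmon1 W).
  by rewrite IH addr0 wmonM.
have E : wext W (pcoef (fun a => mon [:: a]) q 1) f = der W i j f.
  apply: (lin_ext (W := W) (F := wext W _) (G := der W i j)) => u.
  rewrite wext_mon der_mon; elim: u => [|a u IH] //=.
  rewrite IH P0 addrC /q; congr (_ + _).
  by case: eqP => _; rewrite ?mul0r // wmonM.
rewrite -E; apply: (GL_pcoef 1 GLI lin1_gen _ If) => a.
by rewrite /q; case: eqP => _; [exact: lin1_gen | exact: lin1_0].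
Qed.

Definition tcomp (i r : nat) : {linear A -> A} :=
  wext W (fun u => if count_mem i u == r then mon u else 0).

(** The coefficient of t^r under x_i |-> t x_i, all other letters being fixed. *)
Lemma GL_tcomp I i r f : GL_stable I -> I f -> I (tcomp i r f).
Proof.
move=> GLI If; pose p a := if a == i then 0 else mon [:: a].
pose q a := if a == i then mon [:: a] else 0.
have <- : wext W (pcoef p q r) f = tcomp i r f.
  apply: (lin_ext (W := W) (F := wext W _) (G := tcomp i r)) => u.
  rewrite !wext_mon; elim: u r => [|a u IH] r /=.
    by rewrite eq_sym; case: eqP => _; rewrite ?(wmon1 W).
  rewrite IH /p /q; case: eqP => [-> | _].
    rewrite mul0r add0r; case: r => [|r] //=; rewrite IH add1n eqSS.
    by case: eqP => _; rewrite ?mulr0 // wmonM.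
  rewrite add0n; case: r => [|r]; rewrite ?mul0r addr0;
    by case: eqP => _; rewrite ?mulr0 // wmonM.
by apply: (GL_pcoef r GLI _ _ If) => a; rewrite /p /q; case: eqP => _;
  by [exact: lin1_gen | exact: lin1_0].
Qed.

Lemma GL_hcomp I m f : GL_stable I -> I f -> I (hcomp W m f).
Proof.
move=> GLI If.
pose T s : A -> A := foldr (fun i F => F \o tcomp i (count_mem i m)) id s.
have TI s g : I g -> I (T s g).
  by elim: s g => //= i s IH g Ig; apply: IH; apply: GL_tcomp.
have Tmon s u : T s (mon u) =
    if all (fun i => count_mem i u == count_mem i m) s then mon u else 0.
  elim: s => //= i s IH; rewrite /tcomp wext_mon.
  case: eqP => _ /=; first exact: IH.
  by elim: s {IH} => //= j s IH; rewrite /tcomp linear0.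
have TD s g c u : T s (g + c *: mon u) = T s g + c *: T s (mon u).
  have L x h y : T s (h + x *: y) = T s h + x *: T s y.
    elim: s h y => //= i s IH h y; by rewrite linearD linearZ /= IH.
  exact: L.
(* Finitely many letters need to be tested: a letter of a word is at most the sum of its letters. *)
have [n Hn] : exists n, forall s, {subset iota 0 n <= s} -> T s f = hcomp W m f.
  elim/(wbasis_ind (w := W)): f {If} => [|f c u [n IH]].
    exists 0 => s _; rewrite linear0; elim: s => //= i s IH.
    by rewrite /tcomp linear0.
  exists (n + (sumn u + sumn m).+1)%N => s sub_s.
  rewrite TD IH => [|x]; last first.
    by rewrite mem_iota => /andP[_ lt_x]; apply: sub_s; rewrite mem_iota; lia.
  rewrite linearD linearZ /= Tmon hcomp_mon; congr (_ + _ *: _).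
  suff -> : all (fun i => count_mem i u == count_mem i m) s = perm_eq u m by [].
  apply/allP/idP => [E | /permP E i _]; last by rewrite E.
  have le_sumn x v : x \in v -> (x <= sumn v)%N.
    by move/perm_to_rem/perm_sumn => -> /=; rewrite leq_addr.
  apply/allP => x; rewrite mem_cat => xum; apply/E/sub_s; rewrite mem_iota.
  by case/orP: xum => /le_sumn; lia.
by rewrite -(Hn (iota 0 n)) //; apply: TI.
Qed.
End Stability.

(** * Reduction modulo lowering images *)

Section LinearForms.
Variables (K : fieldType) (A : algType K) (W : word_basis A).
Local Notation mon := (wmon W).

(* Words are linearly independent, so linear identities in [A] can be checked
   on scalar-valued forms, that is, by commutative ring normalization. *)
Lemma lin_formP (f g : A) :
  (forall phi : A -> K, (forall a b, phi (a + b) = phi a + phi b) ->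
     (forall a, phi (- a) = - phi a) ->
     (forall c a, phi (c *: a) = c * phi a) -> phi 0 = 0 -> phi f = phi g) ->
  f = g.
Proof.
move=> H; apply/eqP; rewrite -subr_eq0; apply/eqP.
pose phi v : {linear A -> K^o} := wext W (fun u => (u == v)%:R : K^o).
have phi0 v : phi v (f - g) = 0.
  rewrite linearB (H (phi v)) ?subrr // => [a b|a|c a|].
  - exact: linearD.
  - exact: linearN.
  - by rewrite linearZ.
  - exact: linear0.
have [L HL] : exists L : seq (seq nat), forall L', uniq L' ->
    {subset L <= L'} ->
    f - g = \sum_(u <- L') (phi u (f - g) : K) *: mon u.
  elim/(wbasis_ind (w := W)): (f - g) => [|h c u [L IH]].
    exists [::] => L' _ _; rewrite big1_seq // => u _.
    by rewrite linear0 scale0r.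
  exists (u :: L) => L' uL' sub; rewrite [in LHS](IH L') //; last first.
    by move=> x xL; apply: sub; rewrite inE xL orbT.
  have uin : u \in L' by apply: sub; rewrite inE eqxx.
  have Ecu : c *: mon u = \sum_(v <- L') (phi v (c *: mon u) : K) *: mon v.
    rewrite (bigD1_seq u) //= [phi u _]linearZ /= /phi wext_mon eqxx.
    rewrite [c *: 1]mulr1 big1_seq ?addr0 // => v /andP[vu _].
    by rewrite linearZ /= wext_mon eq_sym (negPf vu) scaler0 scale0r.
  rewrite [X in _ + X = _]Ecu -big_split /=; apply: eq_bigr => v _.
  by rewrite -scalerDl; congr (_ *: _); rewrite [RHS]linearD.
rewrite (HL (undup L)) ?undup_uniq // => [|x]; last by rewrite mem_undup.
by rewrite big1_seq // => u _; rewrite phi0 scale0r.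
Qed.
End LinearForms.

Ltac linear_form W :=
  let phi := fresh "phi" in let phiD := fresh in let phiN := fresh in
  let phiZ := fresh in let phi0 := fresh in
  apply: (lin_formP W) => phi phiD phiN phiZ phi0;
  rewrite ?(phiD, phiN, phiZ, phi0); ring.

Ltac perm_lia H :=
  let P := fresh "P" in
  apply/permP => P; move/permP/(_ P): H; rewrite /= ?count_cat /= ?count_cat /=; lia.

Section Lowering.
Variables (K : fieldType) (A : algType K) (W : word_basis A).
Hypothesis K0 : forall n, n.+1%:R != 0 :> K.
Local Notation mon := (wmon W).

(* The span, in multidegree [m], of the images of the lowering operators
   [der i j] with [k <= i < j]. *)
Inductive low (k : nat) (m : seq nat) : A -> Prop :=
| low0 : low k m 0
| low_add f c i j v : low k m f -> (k <= i)%N -> (i < j)%N ->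
    perm_eq (j :: v) (i :: m) -> low k m (f + c *: der W i j (mon v)).

Lemma lowD k m f g : low k m f -> low k m g -> low k m (f + g).
Proof.
move=> Lf; elim=> [|g' c i j v _ IH ki ij pv]; first by rewrite addr0.
by rewrite addrA; apply: low_add.
Qed.

Lemma lowZ k m c f : low k m f -> low k m (c *: f).
Proof.
elim=> [|g' d i j v _ IH ki ij pv]; first by rewrite scaler0; apply: low0.
by rewrite scalerDr scalerA; apply: low_add.
Qed.

Lemma lowN k m f : low k m f -> low k m (- f).
Proof. by rewrite -scaleN1r; apply: lowZ. Qed.

Lemma low_der k m i j v : (k <= i)%N -> (i < j)%N ->
  perm_eq (j :: v) (i :: m) -> low k m (der W i j (mon v)).
Proof.
move=> ki ij pv; rewrite -[der _ _ _ _]scale1r -[X in low _ _ X]add0r.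
by apply: low_add => //; apply: low0.
Qed.

Lemma low_der_homog k m i j v f : (k <= i)%N -> (i < j)%N ->
  perm_eq (j :: v) (i :: m) -> homog W v f -> low k m (der W i j f).
Proof.
move=> ki ij pv; elim/homog_ind => [|f' c u pu IH].
  by rewrite linear0; apply: low0.
rewrite linearD linearZ /=; apply: low_add => //.
by apply: perm_trans pv; rewrite perm_cons.
Qed.

Lemma low_homog k m f : low k m f -> homog W m f.
Proof.
elim=> [|g c i j v _ IH _ _ pv]; first exact: homog0.
apply/homogD/homogZ => //; apply: (der_homog (m := v)).
  by rewrite perm_sym.
exact: homog_mon.
Qed.

Lemma low_perm k m m' f : perm_eq m m' -> low k m f -> low k m' f.
Proof.
move=> pm; elim=> [|g c i j v _ IH ki ij pv]; first exact: low0.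
by apply: low_add => //; apply: perm_trans pv _; rewrite perm_cons.
Qed.

Lemma low_le k k' m f : (k' <= k)%N -> low k m f -> low k' m f.
Proof.
move=> kk; elim=> [|g c i j v _ IH ki ij pv]; first exact: low0.
by apply: low_add => //; apply: leq_trans ki.
Qed.

(** This is what the index [k] of [low] is for: a derivation that moves only letters from k on
    passes through a prefix of smaller letters. *)
Lemma lowMl k m u f : all (fun a => a < k)%N u -> low k m f ->
  low k (u ++ m) (mon u * f).
Proof.
move=> uk; elim=> [|g c i j v _ IH ki ij pv]; first by rewrite mulr0; apply: low0.
rewrite mulrDr -scalerAr.
have -> : mon u * der W i j (mon v) = der W i j (mon (u ++ v)).
  have iu : i \notin u by apply/negP => /(allP uk); rewrite ltnNge ki.
  by rewrite -wmonM derM (der_notin W j iu) mul0r add0r.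
apply: low_add => //; by perm_lia pv.
Qed.

Definition lowI (I : set A) k m (f : A) := exists2 g, I g & low k m (f - g).

Section Ideal.
Variable I : set A.
Hypothesis idI : two_sided_ideal I.

Lemma lowI_ideal k m f : I f -> lowI I k m f.
Proof. by move=> If; exists f => //; rewrite subrr; apply: low0. Qed.

Lemma lowI_low k m f : low k m f -> lowI I k m f.
Proof. by move=> Lf; exists 0; [exact: idl0 | rewrite subr0]. Qed.

Lemma lowID k m f g : lowI I k m f -> lowI I k m g -> lowI I k m (f + g).
Proof.
move=> [f' If' Lf] [g' Ig' Lg]; exists (f' + g'); first exact: idlD.
by rewrite opprD addrACA; apply: lowD.
Qed.

Lemma lowIZ k m c f : lowI I k m f -> lowI I k m (c *: f).
Proof.
move=> [f' If' Lf]; exists (c *: f'); first exact: idlZ.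
by rewrite -scalerBr; apply: lowZ.
Qed.

Lemma lowIB k m f g : lowI I k m f -> lowI I k m g -> lowI I k m (f - g).
Proof. by move=> Lf Lg; rewrite -scaleN1r; apply/lowID/lowIZ. Qed.

Lemma lowI_perm k m m' f : perm_eq m m' -> lowI I k m f -> lowI I k m' f.
Proof. by move=> pm [g Ig Lf]; exists g => //; apply: low_perm pm Lf. Qed.

Lemma lowI_le k k' m f : (k' <= k)%N -> lowI I k m f -> lowI I k' m f.
Proof. by move=> kk [g Ig Lf]; exists g => //; apply: low_le kk Lf. Qed.

Lemma lowIMl k m u f : all (fun a => a < k)%N u -> lowI I k m f ->
  lowI I k (u ++ m) (mon u * f).
Proof.
move=> uk [g Ig Lf]; exists (mon u * g); first exact: idlMl.
by rewrite -mulrBr; apply: lowMl.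
Qed.

Lemma lowI_sub (J : set A) k m f : (forall g, J g -> I g) ->
  lowI J k m f -> lowI I k m f.
Proof. by move=> JI [g /JI Ig Lf]; exists g. Qed.
End Ideal.

Definition cliff (I : set A) := two_sided_ideal I /\
  forall a b c, I (mon [:: a; b; c] + mon [:: b; a; c]
                   - (mon [:: c; a; b] + mon [:: c; b; a])).

Section Clifford.
Variable I : set A.
Hypothesis cI : cliff I.
Let idI : two_sided_ideal I := proj1 cI.

Lemma cliff_central a b u :
  I ((mon [:: a; b] + mon [:: b; a]) * mon u
     - mon u * (mon [:: a; b] + mon [:: b; a])).
Proof.
elim: u => [|x u IH]; first by rewrite (wmon1 W) mulr1 mul1r subrr; apply: idl0.
set z := mon [:: a; b] + mon [:: b; a]; rewrite [mon (x :: u)]mon_cons.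
have -> : z * (mon [:: x] * mon u) - mon [:: x] * mon u * z =
  (z * mon [:: x] - mon [:: x] * z) * mon u + mon [:: x] * (z * mon u - mon u * z).
  by rewrite mulrBl mulrBr !mulrA addrA subrK.
apply: idlD => //; last exact: idlMl.
apply: idlMr => //; rewrite mulrDl mulrDr !wmonM; exact: (proj2 cI).
Qed.

Lemma cliff_move p ys a b g :
  I (mon (p ++ ys ++ a :: b :: g) + mon (p ++ ys ++ b :: a :: g)
     - (mon (p ++ a :: b :: ys ++ g) + mon (p ++ b :: a :: ys ++ g))).
Proof.
have := idlN idI (idlMl idI (mon p) (idlMr idI (mon g) (cliff_central a b ys))).
rewrite -mulrN -mulNr opprB mulrBl mulrBr !(mulrDl, mulrDr) !wmonM.
by rewrite -!catA.
Qed.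

Lemma nseqSr x n (s : seq nat) : nseq n x ++ x :: s = nseq n.+1 x ++ s.
Proof. by elim: n => //= n ->. Qed.

(** With N = n+2, the derivative is the sum of the words x^(N-1-r) y x^r. Since x^2 is central, only
    the parity of r matters: r is even for N/2 rounded up of the terms and odd for N/2 rounded
    down. *)
Lemma der_pow x y n :
  I (der W x y (mon (nseq n.+2 x))
     - ((uphalf n.+2)%:R *: mon (nseq n.+1 x ++ [:: y])
        + (n.+2)./2%:R *: mon (nseq n x ++ [:: y; x]))).
Proof.
have D2 : der W x y (mon [:: x; x]) = mon [:: y; x] + mon [:: x; y].
  by rewrite !der_cons eqxx (wmon1 W) der1 mulr0 addr0 wmonM.
elim/ltn_ind: n => -[|[|n]] IH.
- by rewrite D2 /= !scale1r [mon [:: y; x] + _]addrC subrr; apply: idl0.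
- have -> : nseq 3 x = [:: x; x] ++ [:: x] by [].
  rewrite -wmonM derM D2 der_gen eqxx wmonM mulrDl !wmonM /=.
  have /(idlZK idI (K0 1)) : I (2%:R *: (mon [:: y; x; x] - mon [:: x; x; y])).
    have := idlN idI (proj2 cI x x y); congr (I _); linear_form W.
  by congr (I _); linear_form W.
have -> : nseq n.+4 x = [:: x; x] ++ nseq n.+2 x by [].
rewrite -wmonM derM D2.
have := idlD idI (cliff_central y x (nseq n.+2 x)) (idlMl idI (mon [:: x; x]) (IH n _)).
move/(_ (leqnSn _)).
rewrite [(mon [:: y; x] + _) * _]mulrDl mulrBr !mulrDr -!scalerAr !wmonM.
rewrite [nseq n.+2 x ++ [:: x; y]]nseqSr; congr (I _).
have -> : mon (nseq n.+3 x ++ [:: y]) = mon ([:: x; x] ++ nseq n.+1 x ++ [:: y]) by [].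
have -> : mon (nseq n.+2 x ++ [:: y; x]) = mon ([:: x; x] ++ nseq n x ++ [:: y; x]) by [].
rewrite (_ : uphalf n.+4 = (uphalf n.+2).+1) // (_ : n.+4./2 = (n.+2./2).+1) // -!natr1.
linear_form W.
Qed.

Definition spanI k m e f := exists c : K, lowI I k m (f - c *: e).

Lemma spanID k m e f g : spanI k m e f -> spanI k m e g -> spanI k m e (f + g).
Proof.
move=> [c Lf] [d Lg]; exists (c + d).
by rewrite scalerDl opprD addrACA; apply: lowID.
Qed.

Lemma spanIZ k m e a f : spanI k m e f -> spanI k m e (a *: f).
Proof.
move=> [c Lf]; exists (a * c).
by rewrite -scalerA -scalerBr; apply: lowIZ.
Qed.

Lemma spanIZK k m e a f : a != 0 -> spanI k m e (a *: f) -> spanI k m e f.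
Proof. by move=> a0 /(spanIZ a^-1); rewrite scalerA mulVf // scale1r. Qed.

Lemma spanIB k m e f g : spanI k m e f -> spanI k m e g -> spanI k m e (f - g).
Proof. by move=> Sf Sg; rewrite -scaleN1r; apply/spanID/spanIZ. Qed.

Lemma spanI_lowI k m e f : lowI I k m f -> spanI k m e f.
Proof. by exists 0; rewrite scale0r subr0. Qed.

Lemma spanI_ideal k m e f : I f -> spanI k m e f.
Proof. by move=> If; apply/spanI_lowI/lowI_ideal. Qed.

(** All letters x can be collected in the prefix. The outer induction is on the number of x outside
    it, the inner one on the distance from the prefix to the next x. *)
Lemma spanI_prefix k m x e : (k <= x)%N -> all (leq x) m ->
  (forall s (g : seq nat), x \notin g -> perm_eq (nseq s x ++ g) m ->
     spanI k m e (mon (nseq s x ++ g))) ->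
  forall n s (g : seq nat), (count_mem x g <= n)%N -> perm_eq (nseq s x ++ g) m ->
  spanI k m e (mon (nseq s x ++ g)).
Proof.
move=> kx xm base; elim/ltn_ind=> n IHn s g cg pg.
have [xg | /base] := boolP (x \in g); last exact.
have n0 : (0 < n)%N.
  by apply: leq_trans cg; rewrite -has_count has_pred1.
have [ys [g' Eg]] : exists ys g' : seq nat, g = ys ++ x :: g'.
  by case/splitPr: xg => ys g'; exists ys, g'.
subst g; clear xg; move: cg pg; have [r] := ubnP (size ys).
elim: r ys s g' => // r IHr [|y [|y1 ys]] s g' /= lt_r cg pg.
- rewrite eqxx in cg; rewrite nseqSr in pg *; apply: (IHn n.-1) => //=; lia.
- have [yx | xy] := eqVneq y x.
    subst y; rewrite eqxx in cg; rewrite nseqSr in pg *.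
    by apply: (IHn n.-1) => //=; rewrite ?eqxx; lia.
  have {}xy : (x < y)%N.
    rewrite ltn_neqAle eq_sym xy; apply: (allP xm).
    by rewrite -(perm_mem pg) mem_cat inE eqxx orbT.
  (* Lowering x to y in x^(s+2) g' produces x^s y x g' with coefficient (s+2)/2 rounded down, which
     is at least 1. The remaining terms have fewer letters x outside the prefix. *)
  have := idlMr idI (mon g') (der_pow x y s).
  set h := (s.+2)./2%:R.
  have h0 : h != 0 by rewrite /h /=; apply: K0.
  rewrite mulrBl mulrDl -!scalerAl !wmonM -!catA /= => I1.
  apply: (spanIZK h0).
  have -> : h *: mon (nseq s x ++ [:: y, x & g']) =
     der W x y (mon (nseq s.+2 x ++ g')) - mon (nseq s.+2 x) * der W x y (mon g')
     - (uphalf s.+2)%:R *: mon (nseq s.+1 x ++ y :: g')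
     - (der W x y (mon (nseq s.+2 x)) * mon g' -
        ((uphalf s.+2)%:R *: mon (nseq s.+1 x ++ y :: g') +
         h *: mon (nseq s x ++ [:: y, x & g']))).
    by rewrite -[mon (nseq s.+2 x ++ g')]wmonM derM; linear_form W.
  apply: spanIB; last exact: spanI_ideal.
  apply: spanIB; last first.
    apply: spanIZ; apply: (IHn n.-1) => //=; first by lia.
      by rewrite gtn_eqF //; lia.
    by perm_lia pg.
  apply: spanIB.
    apply/spanI_lowI/lowI_low/low_der => //.
    by perm_lia pg.
  have [xg' | nxg'] := boolP (x \in g'); last first.
    by rewrite der_notin // mulr0; apply: spanI_ideal; apply: idl0.
  have Hh : homog W (y :: rem x g') (der W x y (mon g')).
    apply: (der_homog (m := g')); last exact: homog_mon.
    by perm_lia (perm_to_rem xg').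
  elim/homog_ind: Hh => [|f' c u pu IHf].
    by rewrite mulr0; apply: spanI_ideal; apply: idl0.
  rewrite mulrDr -scalerAr wmonM; apply: spanID => //; apply: spanIZ.
  have pu' P := permP pu P; have px P := permP (perm_to_rem xg') P.
  apply: (IHn n.-1) => /=; first by lia.
    have := pu' (pred1 x); have := px (pred1 x) => /=; rewrite eqxx gtn_eqF //.
    move: cg; rewrite /= eqxx gtn_eqF //; lia.
  apply/permP => P; have := pu' P; have := px P; move/permP/(_ P): pg.
  by rewrite /= ?count_cat /= ?count_cat /=; lia.
(* The anticommutator of x with the letter just before it is central, so it moves in front of the
   rest of the gap. In the other three words the x is closer to the prefix or joins it. *)
- have Ey : y :: y1 :: ys ++ x :: g' = belast y (y1 :: ys) ++ last y (y1 :: ys) :: x :: g'.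
    by rewrite -[RHS]cat_rcons -lastI.
  have lt1r : (1 < r)%N by move: lt_r => /=; lia.
  have sY : (size (belast y (y1 :: ys)) < r)%N by rewrite size_belast.
  have cY : (count_mem x (belast y (y1 :: ys) ++ last y (y1 :: ys) :: x :: g') <= n)%N.
    by rewrite -Ey.
  rewrite {}Ey in pg *; move: (belast _ _) (last _ _) sY cY pg => {cg lt_r y y1} Y z sY cY pg.
  have I1 := cliff_move (nseq s x) Y z x g'.
  have -> : mon (nseq s x ++ Y ++ [:: z, x & g']) =
    (mon (nseq s x ++ Y ++ [:: z, x & g']) + mon (nseq s x ++ Y ++ [:: x, z & g'])
     - (mon (nseq s x ++ [:: z, x & Y ++ g']) + mon (nseq s x ++ [:: x, z & Y ++ g'])))
    - mon (nseq s x ++ Y ++ [:: x, z & g']) + mon (nseq s x ++ [:: z, x & Y ++ g'])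
    + mon (nseq s x ++ [:: x, z & Y ++ g']) by linear_form W.
  have E1 : (count_mem x (z :: Y ++ g') < n)%N.
    by move: cY; rewrite /= !count_cat /= eqxx; lia.
  apply: spanID; last first.
    rewrite nseqSr; apply: (IHn _ E1) => //.
    by perm_lia pg.
  apply: spanID; last first.
    have := IHr [:: z] s (Y ++ g') lt1r; apply.
      by move: cY; rewrite /= !count_cat /= eqxx; lia.
    by perm_lia pg.
  apply: spanIB; first exact: spanI_ideal.
  apply: IHr => //; first by move: cY; rewrite /= !count_cat /= eqxx; lia.
  by perm_lia pg.
Qed.

(** This bounds multiplicities by one: modulo lowering images each multidegree has dimension at most
    1. The smallest letter x goes to the front, and the remaining letters, all larger, are sorted by
    induction at level x+1. *)
Lemma spanI_sort k u : all (leq k) u ->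
  spanI k u (mon (sort leq u)) (mon u).
Proof.
have [n] := ubnP (size u); elim: n k u => // n IH k u lt_n ku.
case Es: (sort leq u) => [|x t].
  have /perm_size/eqP : perm_eq (sort leq u) u by rewrite perm_sort.
  rewrite Es eq_sym size_eq0 => /eqP ->; exists 1.
  by rewrite scale1r subrr; apply/lowI_low/low0.
have pu : perm_eq (x :: t) u by rewrite -Es perm_sort.
have xt : all (leq x) (x :: t).
  have := sort_sorted leq_total u; rewrite Es /= leqnn.
  exact: order_path_min leq_trans.
have xu : all (leq x) u by rewrite -(perm_all _ pu).
have kx : (k <= x)%N by apply: (allP ku); rewrite -(perm_mem pu) inE eqxx.
have := spanI_prefix (e := mon (x :: t)) kx xu _ (n := count_mem x u) (s := 0) (g := u).
apply=> // s g xg pg.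
have s0 : (0 < s)%N.
  case: s pg => // pg; case/negP: xg.
  by rewrite (perm_mem pg) -(perm_mem pu) inE eqxx.
have xg' : all (leq x.+1) g.
  apply/allP => y yg; rewrite ltn_neqAle; apply/andP; split.
    by apply: contraNneq xg => ->.
  by apply: (allP xu); rewrite -(perm_mem pg) mem_cat yg orbT.
have [|c Lc] := IH x.+1 g _ xg'.
  by move: (perm_size pg) lt_n; rewrite size_cat size_nseq /=; lia.
exists c; have -> : x :: t = nseq s x ++ sort leq g.
  rewrite -Es; apply: (sorted_eq leq_trans anti_leq).
  - exact: sort_sorted leq_total _.
  - have : all (leq x) (sort leq g).
      by rewrite all_sort; apply: sub_all xg' => y /ltnW.
    have := sort_sorted leq_total g.
    move: (sort leq g) => h sh xh; elim: s {s0 pg} => //= s.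
    by case: s => [|s] /=; [rewrite (path_sortedE leq_trans) sh andbT | rewrite leqnn].
  - rewrite perm_sort; apply: perm_trans (_ : perm_eq (nseq s x ++ g) _).
      by rewrite perm_sym.
    by rewrite perm_cat2l perm_sym perm_sort.
have := lowIMl idI (u := nseq s x) _ Lc.
rewrite mulrBr -scalerAr !wmonM all_nseq ltnSn orbT => /(_ isT).
move/(lowI_le (leqW kx)); exact: lowI_perm.
Qed.
End Clifford.
End Lowering.

(** * The Casimir operator *)

Section Casimir.
Variables (K : fieldType) (A : algType K) (W : word_basis A).
Hypothesis K0 : forall n, n.+1%:R != 0 :> K.
Local Notation mon := (wmon W).
Local Notation der := (der W).

(** The quadratic Casimir element of gl_n; [n] will bound the letters of the multidegree
    considered. *)
Definition casimir n (f : A) : A := \sum_(i < n) \sum_(j < n) der i j (der j i f).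

Lemma casimirD n f g : casimir n (f + g) = casimir n f + casimir n g.
Proof.
rewrite -big_split /=; apply: eq_bigr => i _; rewrite -big_split /=.
by apply: eq_bigr => j _; rewrite !linearD.
Qed.

Lemma casimirZ n c f : casimir n (c *: f) = c *: casimir n f.
Proof.
rewrite scaler_sumr; apply: eq_bigr => i _; rewrite scaler_sumr.
by apply: eq_bigr => j _; rewrite !linearZ.
Qed.

Lemma sum_delta n k (F : nat -> A) : (k < n)%N ->
  \sum_(i < n) (k == i)%:R *: F i = F k :> A.
Proof.
move=> lt_kn; rewrite (bigD1 (Ordinal lt_kn)) //= eqxx scale1r big1 ?addr0 // => i.
by rewrite -val_eqE /= eq_sym => /negPf ->; rewrite scale0r.
Qed.

(** Centrality of the Casimir element: by [der_comm] the commutator becomes four single sums, which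
    cancel in pairs. *)
Lemma der_casimir n k l f : (k < n)%N -> (l < n)%N ->
  der k l (casimir n f) = casimir n (der k l f).
Proof.
move=> kn ln; apply/eqP; rewrite -subr_eq0; apply/eqP.
have E i j : der k l (der i j (der j i f)) - der i j (der j i (der k l f)) =
   ((k == j)%:R *: der i l (der j i f) - (l == i)%:R *: der k j (der j i f))
   + ((k == i)%:R *: der i j (der j l f) - (l == j)%:R *: der i j (der k i f)).
  have E1 := der_comm W k l i j (der j i f).
  have E2 : der i j (der k l (der j i f)) - der i j (der j i (der k l f)) =
    (k == i)%:R *: der i j (der j l f) - (l == j)%:R *: der i j (der k i f).
    by rewrite -linearB der_comm linearB !linearZ /= (eq_sym j).
  by rewrite -E2 (eq_sym l) -E1 addrA subrK.
rewrite linear_sum -sumrB.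
under eq_bigr do rewrite linear_sum -sumrB.
under eq_bigr do under eq_bigr do rewrite E.
under eq_bigr do rewrite !big_split /= !sumrN -scaler_sumr.
rewrite !big_split /= !sumrN.
under eq_bigr do rewrite (sum_delta (fun j => der _ l (der j _ f)) kn).
rewrite (sum_delta (fun i => \sum_(j < n) der k j (der j i f)) ln).
under [X in _ + (X - _)]eq_bigr do rewrite -scaler_sumr.
rewrite (sum_delta (fun i => \sum_(j < n) der i j (der j l f)) kn).
under [X in _ + (_ - X)]eq_bigr do rewrite (sum_delta (fun j => der _ j (der k _ f)) ln).
by rewrite addrA subrK subrr.
Qed.

Lemma der_diag_homog i m f : homog W m f -> der i i f = (count_mem i m)%:R *: f.
Proof.
elim/homog_ind => [|f' c u pu IH]; first by rewrite linear0 scaler0.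
rewrite linearD linearZ /= IH der_diag scalerDr (permP pu) !scalerA.
by rewrite [c * _]mulrC.
Qed.

(** With rho half the sum of the positive roots, this is |m + rho|^2 - |rho|^2, the eigenvalue on a
    highest weight vector of weight m. *)
Definition casimir_val n (m : seq nat) : int :=
  \sum_(i < n) (count_mem (val i) m)%:Z ^+ 2
   + \sum_(i < n) \sum_(j < n | (i < j)%N)
       ((count_mem (val i) m)%:Z - (count_mem (val j) m)%:Z).

(** Normal ordering: each product in which the lowering operator acts first is rewritten with the
    raising operator first. The commutators contribute the differences of multiplicities. *)
Lemma casimir_homog n m f : homog W m f ->
  casimir n f = (casimir_val n m)%:~R *: f
    + 2%:R *: \sum_(i < n) \sum_(j < n | (i < j)%N) der i j (der j i f).
Proof.
move=> Hf; pose G i j := der i j (der j i f).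
have split3 (i : 'I_n) : \sum_(j < n) G i j =
    G i i + \sum_(j < n | (i < j)%N) G i j + \sum_(j < n | (j < i)%N) G i j.
  rewrite (bigID (fun j : 'I_n => (i < j)%N)) /= addrC [RHS]addrAC; congr (_ + _).
  rewrite (bigD1 i) ?ltnn //=; congr (_ + _); apply: eq_bigl => j.
  by rewrite -leqNgt ltn_neqAle -val_eqE andbC.
rewrite /casimir (eq_bigr _ (fun i _ => split3 i)) !big_split /=.
rewrite [X in _ + _ + X](exchange_big_dep xpredT) //=.
have -> : \sum_(j < n) \sum_(i < n | (j < i)%N) G i j =
   \sum_(i < n) \sum_(j < n | (i < j)%N) G i j
   + (\sum_(i < n) \sum_(j < n | (i < j)%N)
       ((count_mem (val i) m)%:Z - (count_mem (val j) m)%:Z))%:~R *: f.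
  rewrite rmorph_sum /= scaler_suml -big_split /=; apply: eq_bigr => i _.
  rewrite rmorph_sum /= scaler_suml -big_split /=; apply: eq_bigr => j _.
  have := der_comm W j i i j f; rewrite !eqxx !scale1r.
  rewrite !(der_diag_homog _ Hf) -scalerBl rmorphB /= => <-.
  by rewrite addrC subrK.
have -> : \sum_(i < n) G i i = (\sum_(i < n) (count_mem (val i) m)%:Z ^+ 2)%:~R *: f.
  rewrite rmorph_sum /= scaler_suml; apply: eq_bigr => i _.
  by rewrite /G !(der_diag_homog _ Hf) linearZ /= (der_diag_homog _ Hf) scalerA rmorphXn.
rewrite /casimir_val rmorphD /= scalerDl; linear_form W.
Qed.

Definition casimir_shift n (t : int) f := casimir n f - t%:~R *: f.

Definition casimir_prod n (ts : seq int) (f : A) : A := foldr (casimir_shift n) f ts.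

Lemma casimir_shiftD n t f g :
  casimir_shift n t (f + g) = casimir_shift n t f + casimir_shift n t g.
Proof. by rewrite /casimir_shift casimirD scalerDr opprD addrACA. Qed.

Lemma casimir_shiftZ n t c f : casimir_shift n t (c *: f) = c *: casimir_shift n t f.
Proof. by rewrite /casimir_shift casimirZ scalerBr !scalerA [c * _]mulrC. Qed.

Lemma casimir_shiftC n s t f :
  casimir_shift n s (casimir_shift n t f) = casimir_shift n t (casimir_shift n s f).
Proof.
rewrite /casimir_shift -!scaleNr !casimirD !casimirZ; linear_form W.
Qed.

Lemma casimir_prodD n ts f g :
  casimir_prod n ts (f + g) = casimir_prod n ts f + casimir_prod n ts g.
Proof. by elim: ts => //= t ts ->; rewrite casimir_shiftD. Qed.

Lemma casimir_prodZ n ts c f : casimir_prod n ts (c *: f) = c *: casimir_prod n ts f.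
Proof. by elim: ts => //= t ts ->; rewrite casimir_shiftZ. Qed.

Lemma casimir_prod_cat n ts ss f :
  casimir_prod n (ts ++ ss) f = casimir_prod n ts (casimir_prod n ss f).
Proof. exact: foldr_cat. Qed.

Lemma casimir_prodC n ts ss f :
  casimir_prod n ts (casimir_prod n ss f) = casimir_prod n ss (casimir_prod n ts f).
Proof.
elim: ts => //= t ts ->; elim: ss => //= s ss IH.
by rewrite casimir_shiftC IH.
Qed.

Lemma der_casimir_prod n ts k l f : (k < n)%N -> (l < n)%N ->
  der k l (casimir_prod n ts f) = casimir_prod n ts (der k l f).
Proof.
move=> kn ln; elim: ts => //= t ts IH.
by rewrite linearB linearZ /= der_casimir // IH.
Qed.

(** Weaker than an ideal on purpose: the zero subspace qualifies, so the same lemmas give identities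
    in A and congruences modulo a GL-ideal. *)
Definition der_stable (J : set A) := [/\ J 0%R,
  forall f g, J f -> J g -> J (f + g)%R, forall c f, J f -> J (c *: f)
  & forall i j f, J f -> J (der i j f)].

Lemma der_stable0 : der_stable (fun f => f = 0).
Proof. by split=> [//|f g -> ->|c f ->|i j f ->]; rewrite ?addr0 ?scaler0 ?linear0. Qed.

Section Kill.
Variables (n : nat) (m : seq nat).
Hypotheses (mn : all (fun a => a < n)%N m)
  (dom : forall i j, (i < j)%N -> (count_mem j m <= count_mem i m)%N).

(* [f] is killed modulo [J] by a product of factors [casimir - t] whose
   [t] are larger than the value of the Casimir operator on a highest weight
   vector of weight [m]. *)
Definition killed (J : set A) (f : A) := exists ts : seq int,
  all (fun t : int => casimir_val n m < t)%R ts /\ J (casimir_prod n ts f).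

Section Stable.
Variable J : set A.
Hypothesis sJ : der_stable J.

Lemma casimir_stable f : J f -> J (casimir n f).
Proof.
case: sJ => J0 JD JZ Jd Jf; apply: big_ind => // i _; apply: big_ind => // j _.
by apply/Jd/Jd.
Qed.

Lemma casimir_prod_stable ts f : J f -> J (casimir_prod n ts f).
Proof.
case: (sJ) => J0 JD JZ Jd Jf; elim: ts => //= t ts IH.
apply: JD; first exact: casimir_stable.
by rewrite -scaleN1r; apply/JZ/JZ.
Qed.

Lemma killed_mem f : J f -> killed J f.
Proof. by exists [::]. Qed.

Lemma killedD f g : killed J f -> killed J g -> killed J (f + g).
Proof.
case: (sJ) => J0 JD JZ Jd [ts [ats Jts]] [ss [ass Jss]].
exists (ts ++ ss); rewrite all_cat ats ass; split=> //.
rewrite casimir_prod_cat !casimir_prodD; apply: JD; last exact: casimir_prod_stable.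
by rewrite casimir_prodC; apply: casimir_prod_stable.
Qed.

Lemma killedZ c f : killed J f -> killed J (c *: f).
Proof.
case: (sJ) => J0 JD JZ Jd [ts [ats Jts]]; exists ts; split=> //.
by rewrite casimir_prodZ; apply: JZ.
Qed.

Lemma killed_der k l f : (k < n)%N -> (l < n)%N -> killed J f -> killed J (der k l f).
Proof.
case: (sJ) => J0 JD JZ Jd kn ln [ts [ats Jts]]; exists ts; split=> //.
by rewrite -der_casimir_prod //; apply: Jd.
Qed.

Lemma killed_sum (T : Type) (r : seq T) (P : pred T) (F : T -> A) :
  (forall i, P i -> killed J (F i)) -> killed J (\sum_(i <- r | P i) F i).
Proof.
move=> H; apply: big_ind => //; last exact: killedD.
by apply: killed_mem; case: sJ.
Qed.
End Stable.

Lemma sum_pairs (a : nat -> int) k :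
  \sum_(i < k) \sum_(j < k | (i < j)%N) (a i - a j) =
  \sum_(i < k) a i * (k%:Z - 1 - i%:Z *+ 2).
Proof.
elim: k => [|k IH]; first by rewrite !big_ord0.
rewrite !big_ord_recr /= [X in _ + X]big1 ?addr0 => [|i]; last first.
  by rewrite ltnNge -ltnS ltn_ord.
under eq_bigr => i _ do rewrite big_mkcond big_ord_recr /= ltn_ord -big_mkcond /=.
rewrite big_split /= IH sumrB sumr_const card_ord.
have -> : \sum_(i < k) a i * (k.+1%:Z - 1 - i%:Z *+ 2) =
          \sum_(i < k) a i * (k%:Z - 1 - i%:Z *+ 2) + \sum_(i < k) a i.
  by rewrite -big_split; apply: eq_bigr => i _ /=; rewrite intS; ring.
rewrite -mulr_natr intS natz; ring.
Qed.

Lemma sum_count_mem (u : seq nat) (g : nat -> nat) : all (fun a => a < n)%N u ->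
  \sum_(i < n) (count_mem (val i) u)%:Z * (g i)%:Z = (\sum_(a <- u) g a)%N%:Z.
Proof.
elim: u => [|b u IH] /= => [_|/andP[bn un]].
  by rewrite big_nil big1 // => i _; rewrite mul0r.
rewrite big_cons PoszD -IH //.
under [LHS]eq_bigr do rewrite PoszD mulrDl.
rewrite big_split /=; congr (_ + _).
rewrite (bigD1 (Ordinal bn)) //= eqxx mul1r big1 ?addr0 // => i.
by rewrite -val_eqE /= eq_sym => /negPf ->; rewrite mul0r.
Qed.

(* Up to a constant this is the linear part of [casimir_val] around [m]: for
   words of the length of [m], [casimir_val] minus the total weight is minimal
   at [m]. *)
Definition height_wt a := ((count_mem a m).*2 + (n - a).*2)%N.

Lemma height_wt_lt i j : (i < j)%N -> (j < n)%N -> (height_wt j < height_wt i)%N.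
Proof. by move=> ij jn; have := dom ij; rewrite /height_wt; lia. Qed.

(** With u_i, m_i the multiplicities, right minus left is the sum of (u_i - m_i)^2 minus (n+1) times
    the sum of u_i - m_i, and the latter sum is 0 for words of equal length. *)
Lemma casimir_val_le u : all (fun a => a < n)%N u -> size u = size m ->
  (casimir_val n m + (\sum_(a <- u) height_wt a)%N%:Z
    <= casimir_val n u + (\sum_(a <- m) height_wt a)%N%:Z)%R.
Proof.
move=> un szu; rewrite -!sum_count_mem // /casimir_val.
rewrite (sum_pairs (fun i => (count_mem i m)%:Z)) (sum_pairs (fun i => (count_mem i u)%:Z)).
have sz v : all (fun a => a < n)%N v -> \sum_(i < n) (count_mem (val i) v)%:Z = (size v)%:Z.
  move=> vn; have := sum_count_mem (fun _ => 1%N) vn.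
  rewrite sum1_size => <-; by apply: eq_bigr => i _; rewrite mulr1.
have E : \sum_(i < n) ((count_mem (val i) u)%:Z - (count_mem (val i) m)%:Z) = 0.
  by rewrite sumrB !sz // szu subrr.
rewrite -Num.Theory.subr_ge0 -!big_split /= -sumrB.
have -> : \sum_(i < n) ((count_mem (val i) u)%:Z ^+ 2 +
   (count_mem (val i) u)%:Z * (n%:Z - 1 - i%:Z *+ 2) +
   (count_mem (val i) m)%:Z * (height_wt i)%:Z -
   ((count_mem (val i) m)%:Z ^+ 2 + (count_mem (val i) m)%:Z * (n%:Z - 1 - i%:Z *+ 2) +
    (count_mem (val i) u)%:Z * (height_wt i)%:Z))
  = \sum_(i < n) ((count_mem (val i) u)%:Z - (count_mem (val i) m)%:Z) ^+ 2
    - (n%:Z + 1) * \sum_(i < n) ((count_mem (val i) u)%:Z - (count_mem (val i) m)%:Z).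
  rewrite mulr_sumr -sumrB; apply: eq_bigr => i _.
  rewrite /height_wt PoszD -!muln2 !PoszM -subzn ?(ltnW (ltn_ord i)) //; ring.
rewrite E mulr0 subr0; apply: Num.Theory.sumr_ge0 => i _.
exact: Num.Theory.sqr_ge0.
Qed.

(** By [casimir_homog], the factor for t = [casimir_val n u] sends the word to derivatives of words
    in which a letter j became a smaller i. These have larger total height, so induction applies,
    and the height is bounded by [M]. This t is admissible by [casimir_val_le]. *)
Lemma killed_word u : all (fun a => a < n)%N u -> size u = size m ->
  (\sum_(a <- m) height_wt a < \sum_(a <- u) height_wt a)%N ->
  killed (fun f => f = 0) (mon u).
Proof.
have s0 := der_stable0.
pose M := (size m * ((size m).*2 + n.*2))%N.
have bound v : size v = size m -> (\sum_(a <- v) height_wt a <= M)%N.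
  move=> szv; rewrite /M -{1}szv; elim: v {szv} => [|a v IH]; first by rewrite big_nil.
  rewrite big_cons /= mulSn leq_add // /height_wt leq_add // leq_double ?leq_subr //.
  exact: count_size.
clearbody M; have [k] := ubnP (M - \sum_(a <- u) height_wt a)%N.
elim: k u => // k IH u lt_k un szu lt_mu.
pose r := \sum_(i < n) \sum_(j < n | (i < j)%N) der i j (der j i (mon u)).
have [ts [ats kts]] : killed (fun f => f = 0) (2%:R *: r).
  apply: killedZ => //; apply: killed_sum => // i _; apply: killed_sum => // j ij.
  apply: killed_der => //.
  have [ju | /(der_notin W i) ->] := boolP (val j \in u); last first.
    exact: killed_mem.
  have Hh : homog W (val i :: rem (val j) u) (der j i (mon u)).
    apply: (der_homog (m := u)); last exact: homog_mon.
    by perm_lia (perm_to_rem ju).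
  elim/homog_ind: Hh => [|f' c w pw IHf]; first exact: killed_mem.
  apply: killedD => //; apply: killedZ => //.
  have lt_uw : (\sum_(a <- u) height_wt a < \sum_(a <- w) height_wt a)%N.
    rewrite (perm_big _ (perm_to_rem ju)) (perm_big _ pw) !big_cons ltn_add2r.
    exact: height_wt_lt (ltn_ord j).
  have szw : size w = size m.
    rewrite (perm_size pw) -szu (perm_size (perm_to_rem ju)) //.
  apply: IH => //.
  - move: (bound w szw) lt_k lt_uw.
    move: (\sum_(a <- w) _)%N (\sum_(a <- u) _)%N => x y; lia.
  - rewrite (perm_all _ pw) /= ltn_ord /=; apply/allP => x /mem_rem.
    exact: (allP un).
  - exact: ltn_trans lt_uw.
exists (ts ++ [:: casimir_val n u]); split.
  rewrite all_cat ats /= andbT.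
  by have := casimir_val_le un szu; lia.
rewrite casimir_prod_cat /= /casimir_shift (casimir_homog _ (homog_mon W (perm_refl u))).
by rewrite -/r addrAC subrr add0r.
Qed.

(** In a lowering image [der i j (mon v)] the word v has an i in place of a j of m, hence larger
    height than m; and killing commutes with derivations. *)
Lemma low_killed J f : der_stable J -> low W 0 m f -> killed J f.
Proof.
move=> sJ; elim=> [|g c i j v _ IH _ ij pv].
  by apply: killed_mem; case: sJ.
have jm : j \in m.
  have : j \in i :: m by rewrite -(perm_mem pv) inE eqxx.
  by rewrite inE gtn_eqF.
have jn := allP mn _ jm; have iN := ltn_trans ij jn.
apply: killedD => //; apply: killedZ => //; apply: killed_der => //.
have szv : size v = size m by have [] := perm_size pv.
have [||ts [ats kts]] := @killed_word v _ szv.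
- apply/allP => x xv; have : x \in i :: m by rewrite -(perm_mem pv) inE xv orbT.
  by rewrite inE => /orP[/eqP -> // | /(allP mn)].
- have : (\sum_(a <- j :: v) height_wt a = \sum_(a <- i :: m) height_wt a)%N.
    exact: perm_big.
  by rewrite !big_cons; have := height_wt_lt ij jn; lia.
by exists ts; split=> //; rewrite kts; case: sJ.
Qed.
(** The scalar by which [casimir_prod n ts] acts on a highest weight vector of weight m. *)
Definition casimir_coef (ts : seq int) : K := \prod_(t <- ts) (casimir_val n m - t)%:~R.

Lemma casimir_coef_neq0 (ts : seq int) : all (fun t : int => casimir_val n m < t)%R ts ->
  casimir_coef ts != 0.
Proof.
move=> ats; rewrite /casimir_coef prodf_seq_neq0; apply: sub_all ats => t lt_t /=.
have [k ->] : exists k, casimir_val n m - t = - k.+1%:Z.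
  by exists (absz (t - casimir_val n m - 1)%R); lia.
by rewrite rmorphN oppr_eq0 K0.
Qed.

Lemma casimir_raise_ideal J f : der_stable J -> homog W m f ->
  (forall i j, (i < j)%N -> J (der j i f)) ->
  J (casimir n f - (casimir_val n m)%:~R *: f).
Proof.
case=> J0 JD JZ Jd Hf rf; rewrite (casimir_homog _ Hf) addrAC subrr add0r.
apply: JZ; apply: big_ind => // i _; apply: big_ind => // j ij.
exact/Jd/rf.
Qed.

Lemma casimir_low f : homog W m f ->
  low W 0 m (casimir n f - (casimir_val n m)%:~R *: f).
Proof.
move=> Hf; rewrite (casimir_homog _ Hf) addrAC subrr add0r.
apply: lowZ; apply: big_ind => [||i _]; [exact: low0 | exact: lowD |].
apply: big_ind => [||j ij]; [exact: low0 | exact: lowD |].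
have [jm | jm] := boolP (val j \in m); last first.
  by rewrite (der_homog_notin i Hf jm) linear0; apply: low0.
have Hh : homog W (val i :: rem (val j) m) (der j i f).
  by apply: der_homog Hf; perm_lia (perm_to_rem jm).
by apply: low_der_homog Hh => //; perm_lia (perm_to_rem jm).
Qed.

(* Modulo [J] the Casimir operator is scalar on [f], since the raised vectors of
   [f] lie in [J]; but a product of [casimir - t] with other [t] annihilates the
   lowering images, and hence [f]. *)
Lemma low_raise_ideal J f : der_stable J -> homog W m f -> lowI W J 0 m f ->
  (forall i j, (i < j)%N -> J (der j i f)) -> J f.
Proof.
move=> sJ Hf [g Jg Lg] rf; have [J0 JD JZ Jd] := sJ.
have [ts [ats Jts]] : killed J f.
  rewrite -(subrK g f); apply: killedD => //; last exact: killed_mem.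
  exact: low_killed.
have E : J (casimir_prod n ts f - casimir_coef ts *: f).
  elim: ts {ats Jts} => [|t ts IH] /=.
    by rewrite /casimir_coef big_nil scale1r subrr.
  rewrite /casimir_coef big_cons -/(casimir_coef ts).
  have -> : casimir_shift n t (casimir_prod n ts f) -
      ((casimir_val n m - t)%:~R * casimir_coef ts) *: f =
    casimir_shift n t (casimir_prod n ts f - casimir_coef ts *: f) +
    casimir_coef ts *: (casimir n f - (casimir_val n m)%:~R *: f).
    rewrite casimir_shiftD -[- (casimir_coef ts *: f)]scaleNr casimir_shiftZ.
    rewrite /casimir_shift rmorphB /=.
    linear_form W.
  apply: JD; last by apply: JZ; apply: casimir_raise_ideal.
  apply: (casimir_prod_stable sJ [:: t]) => //.
have /(JZ (casimir_coef ts)^-1) : J (casimir_coef ts *: f).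
  have := JD _ _ Jts (JZ (-1) _ E); congr (J _); linear_form W.
by rewrite scalerA mulVf ?casimir_coef_neq0 // scale1r.
Qed.

Lemma killed_raise i j f : (i < j)%N -> (j < n)%N -> homog W m f ->
  killed (fun f => f = 0) (der j i f).
Proof.
move=> ij jn Hf.
have s0 := der_stable0.
have [jm | jm] := boolP (j \in m); last first.
  by rewrite (der_homog_notin i Hf jm); apply: killed_mem.
have Hh : homog W (i :: rem j m) (der j i f).
  by apply: der_homog Hf; perm_lia (perm_to_rem jm).
elim/homog_ind: Hh => [|f' c w pw IHf]; first exact: killed_mem.
apply: killedD => //; apply: killedZ => //; apply: killed_word.
- rewrite (perm_all _ pw) /= (ltn_trans ij jn) /=; apply/allP => x /mem_rem.
  exact: (allP mn).
- by rewrite (perm_size pw) (perm_size (perm_to_rem jm)).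
rewrite (perm_big _ (perm_to_rem jm)) (perm_big _ pw) !big_cons ltn_add2r.
exact: height_wt_lt ij jn.
Qed.

(** A polynomial in the Casimir operator serves as extremal projector. One product of factors kills
    all raised vectors of [f], and it commutes with raising, so its value at [f] is a highest weight
    vector. Modulo lowering images it is a nonzero scalar, which is divided out. *)
Lemma highest_weight_proj f : homog W m f -> exists f',
  [/\ low W 0 m (f' - f), forall i j, (i < j)%N -> der j i f' = 0
    & forall J, der_stable J -> J f -> J f'].
Proof.
move=> Hf.
have common (s : seq A) : (forall x, x \in s -> killed (fun f => f = 0) x) ->
    exists ts, all (fun t : int => casimir_val n m < t)%R ts /\
      forall x, x \in s -> casimir_prod n ts x = 0.
  have prod0 ts : casimir_prod n ts 0 = 0.
    by have := casimir_prodZ n ts 0 0; rewrite !scale0r.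
  elim: s => [|x s IH] H; first by exists [::].
  have [y ys|ts [ats kts]] := IH; first by apply: H; rewrite inE ys orbT.
  have [ss [ass kss]] := H x (mem_head _ _).
  exists (ts ++ ss); rewrite all_cat ats ass; split=> // y.
  rewrite inE casimir_prod_cat => /orP[/eqP -> | /kts]; first by rewrite kss prod0.
  by rewrite casimir_prodC => ->; rewrite prod0.
have [|ts [ats kts]] := common [seq (if (p.1 < p.2)%N then der p.2 p.1 f else 0) |
    p <- [seq (i, j) | i <- iota 0 n, j <- iota 0 n]].
  move=> _ /mapP[_ /allpairsP[[i j] [/= _ jn ->]] ->] /=.
  case: ifP => ij; last exact: killed_mem.
  by apply: killed_raise => //; rewrite mem_iota in jn.
pose f' := (casimir_coef ts)^-1 *: casimir_prod n ts f.
have Lf' : low W 0 m (f' - f).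
  have -> : f' - f = (casimir_coef ts)^-1 *: (casimir_prod n ts f - casimir_coef ts *: f).
    by rewrite scalerBr scalerA mulVf ?casimir_coef_neq0 // scale1r.
  apply: lowZ; elim: ts {ats kts f'} => [|t ts IH] /=.
    by rewrite /casimir_coef big_nil scale1r subrr; apply: low0.
  rewrite /casimir_coef big_cons -/(casimir_coef ts).
  have -> : casimir_shift n t (casimir_prod n ts f) -
      ((casimir_val n m - t)%:~R * casimir_coef ts) *: f =
    (casimir n (casimir_prod n ts f) - (casimir_val n m)%:~R *: casimir_prod n ts f)
    + (casimir_val n m - t)%:~R *: (casimir_prod n ts f - casimir_coef ts *: f).
    by rewrite /casimir_shift rmorphB /=; linear_form W.
  apply: lowD; last exact: lowZ.
  apply: casimir_low; rewrite -(subrK (casimir_coef ts *: f) (casimir_prod _ _ _)).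
  by apply: homogD; [exact: low_homog IH | exact: homogZ].
exists f'; split=> // [i j ij | J sJ Jf].
  (* For j >= n the letter j does not occur in m, and there is nothing to raise. *)
  have [jn | le_nj] := ltnP j n.
    rewrite linearZ /= der_casimir_prod ?(ltn_trans ij jn) // kts ?scaler0 //.
    apply/mapP; exists (i, j); last by rewrite /= ij.
    by apply/allpairsP; exists (i, j); rewrite !mem_iota (ltn_trans ij jn).
  have Hf' : homog W m f' by rewrite -(subrK f f'); apply/homogD => //; apply: low_homog Lf'.
  apply: der_homog_notin Hf' _.
  by apply/negP => /(allP mn); rewrite ltnNge le_nj.
by case: (sJ) => _ _ JZ _; apply: JZ; apply: casimir_prod_stable.
Qed.
End Kill.
End Casimir.

(** * Highest weight vectors of one-column shape *)

Section Sign.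
Variables (K : fieldType) (A : algType K) (W : word_basis A).
Hypothesis K0 : forall n, n.+1%:R != 0 :> K.
Local Notation mon := (wmon W).
Local Notation der := (der W).

Fixpoint inversions (u : seq nat) : nat :=
  if u is a :: u' then (count (fun b => b < a)%N u' + inversions u')%N else 0.

Definition cross_inversions (u v : seq nat) : nat :=
  (\sum_(a <- u) count (fun b => b < a)%N v)%N.

Lemma inversions_cat u v :
  inversions (u ++ v) = (inversions u + inversions v + cross_inversions u v)%N.
Proof.
elim: u => [|a u IH] /=; first by rewrite /cross_inversions big_nil addn0.
by rewrite IH count_cat /cross_inversions big_cons; lia.
Qed.

Lemma cross_inversions_perm u u' v v' : perm_eq u u' -> perm_eq v v' ->
  cross_inversions u v = cross_inversions u' v'.
Proof.
move=> pu pv; rewrite /cross_inversions (perm_big _ pu).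
by apply: eq_bigr => a _; rewrite (permP pv).
Qed.

(* The value of a word at an orthonormal basis of a Clifford algebra, up to the
   basis monomial determined by its multidegree. *)
Definition sgn : {linear A -> K^o} := wext W (fun u => (-1) ^+ inversions u : K^o).

Lemma sgn_mon u : sgn (mon u) = (-1) ^+ inversions u :> K.
Proof. by rewrite /sgn wext_mon. Qed.

Lemma sgnD f g : sgn (f + g) = sgn f + sgn g :> K.
Proof. exact: linearD. Qed.

Lemma sgnZ c f : sgn (c *: f) = c * sgn f :> K.
Proof. by rewrite linearZ. Qed.

(** Inversions between the two factors depend on the multidegrees alone. Consequently a product of
    homogeneous elements with nonzero [sgn] again has nonzero [sgn]. *)
Lemma sgnM m1 m2 f g : homog W m1 f -> homog W m2 g ->
  sgn (f * g) = (-1) ^+ cross_inversions m1 m2 * (sgn f * sgn g) :> K.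
Proof.
move=> Hf; elim/homog_ind => [|g' c v pv IH].
  by rewrite mulr0 !linear0 !mulr0.
rewrite mulrDr sgnD IH -(scalerAr c f) sgnZ sgnD sgnZ 2!mulrDr; congr (_ + _).
rewrite (mulrCA _ c) [RHS]mulrCA; congr (_ * _) => {g' IH c}.
elim/homog_ind: Hf => [|f' c u pu IH]; first by rewrite mul0r !linear0 mul0r mulr0.
rewrite mulrDl sgnD IH -(scalerAl c (mon u)) sgnZ sgnD sgnZ mulrDl mulrDr; congr (_ + _).
rewrite -mulrA [RHS]mulrCA; congr (_ * _).
rewrite wmonM !sgn_mon inversions_cat !exprD (cross_inversions_perm pu pv).
by rewrite mulrC.
Qed.

Lemma sgn_swap p a b s : a != b ->
  (-1) ^+ inversions (p ++ a :: b :: s) = - (-1) ^+ inversions (p ++ b :: a :: s) :> K.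
Proof.
have W_ x y : (x < y)%N ->
    inversions (p ++ y :: x :: s) = (inversions (p ++ x :: y :: s)).+1.
  move=> xy; rewrite !inversions_cat /=.
  have -> : cross_inversions p (y :: x :: s) = cross_inversions p (x :: y :: s).
    by apply: cross_inversions_perm => //; apply/permP => P /=; lia.
  by rewrite xy ltnNge ltnW //=; lia.
rewrite neq_ltn => /orP[] /W_ ->; rewrite exprS mulN1r ?opprK //.
Qed.

(** The kernel of x_i |-> t_i e_i, with orthonormal Clifford generators e_i and commuting parameters
    t_i that keep multidegrees apart. The flanking words make the ideal property immediate. *)
Definition sgn_kernel : set A := fun f =>
  forall m u v, sgn (hcomp W m (mon u * f * mon v)) = 0 :> K.

Lemma sgn_kernel_ideal : two_sided_ideal sgn_kernel.
Proof.
split=> [m u v|f g kf kg m u v|f g kg].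
- by rewrite mulr0 mul0r !linear0.
- by rewrite mulrDr mulrDl !linearD /= kf kg addr0.
split=> m u v.
  rewrite mulrA; elim/(wbasis_ind (w := W)): f => [|f c w IH].
    by rewrite mulr0 !mul0r !linear0.
  rewrite mulrDr 2!mulrDl !linearD /= IH add0r -!(scalerAr, scalerAl) wmonM !linearZ /=.
  by rewrite kg scaler0.
rewrite -!mulrA; elim/(wbasis_ind (w := W)): f => [|f c w IH].
  by rewrite mul0r !mulr0 !linear0.
rewrite mulrDl 2!mulrDr !linearD /= IH add0r -!(scalerAl, scalerAr) wmonM !linearZ /=.
by rewrite mulrA kg scaler0.
Qed.

Lemma sgn_kernel_homog m f : homog W m f -> sgn_kernel f -> sgn f = 0 :> K.
Proof. by move=> Hf /(_ m [::] [::]); rewrite (wmon1 W) mul1r mulr1 Hf. Qed.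

Lemma lin1_ind (P : A -> Prop) : (forall a, P (mon [:: a])) -> P 0 ->
  (forall f g, P f -> P g -> P (f + g)) -> (forall c f, P f -> P (c *: f)) ->
  forall f, lin1 W f -> P f.
Proof.
move=> Pm P0 PD PZ f [n [c ->]]; apply: big_ind => // i _; exact/PZ/Pm.
Qed.

Lemma sgn_kernel_lin1 p q r : lin1 W p -> lin1 W q -> lin1 W r ->
  sgn_kernel ((p * q + q * p) * r - r * (p * q + q * p)).
Proof.
move=> lp lq lr.
have Z0 := idl0 sgn_kernel_ideal; have ZD := idlD sgn_kernel_ideal.
have ZZ := idlZ sgn_kernel_ideal.
elim/lin1_ind: lr => [c||f g Hf Hg|c f Hf].
- elim/lin1_ind: lq => [b||f g Hf Hg|x f Hf].
  + elim/lin1_ind: lp => [a||f g Hf Hg|x f Hf].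
    * rewrite mulrDl mulrDr !wmonM /= => m u v.
      rewrite mulrBr mulrBl !mulrDr !mulrDl !wmonM -!catA.
      rewrite linearB !linearD /= !hcomp_mon.
      (* The four words have one multidegree, so [hcomp] keeps or drops them together. *)
      have perm x y z : perm_eq [:: x; y; z] [:: a; b; c] ->
          perm_eq (u ++ [:: x; y; z] ++ v) m = perm_eq (u ++ [:: a; b; c] ++ v) m.
        move=> pxyz; apply: permPl; rewrite perm_cat2l perm_cat2r //.
      rewrite (perm b a c) ?(perm c a b) ?(perm c b a); first last.
      - by apply/permP => P /=; lia.
      - by apply/permP => P /=; lia.
      - by apply/permP => P /=; lia.
      case: ifP => _; last by rewrite !(linear0, addr0, subr0).
      rewrite !linearN /= !sgn_mon /=.
      (* Distinct e_a and e_b anticommute, so their anticommutator is 0; for a = b, moving the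
         square past e_c changes the sign twice or not at all. *)
      have [<- | ab] := eqVneq a b; last first.
        rewrite (sgn_swap u (c :: v) ab).
        rewrite -(cat_rcons c u [:: a, b & v]) -(cat_rcons c u [:: b, a & v]).
        by rewrite (sgn_swap (rcons u c) v ab) addNr add0r opprK subrr.
      have [<- | ac] := eqVneq a c; first by rewrite -opprD subrr.
      have -> : (-1) ^+ inversions (u ++ [:: a, a, c & v]) =
                (-1) ^+ inversions (u ++ [:: c, a, a & v]) :> K.
        rewrite -[u ++ [:: a, a, c & v]]cat_rcons (sgn_swap _ _ ac) cat_rcons.
        by rewrite (sgn_swap _ _ ac) opprK.
      by rewrite -opprD subrr.
    * by rewrite mul0r mulr0 addr0 mul0r mulr0 subrr.
    * have -> : (f + g) * mon [:: b] + mon [:: b] * (f + g) =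
         (f * mon [:: b] + mon [:: b] * f) + (g * mon [:: b] + mon [:: b] * g).
        by rewrite mulrDl mulrDr addrACA.
      by rewrite mulrDl mulrDr opprD addrACA; apply: ZD.
    * by rewrite -scalerAl -scalerAr -scalerDr -scalerAl -scalerAr -scalerBr; apply: ZZ.
  + by rewrite mul0r mulr0 addr0 mul0r mulr0 subrr.
  + have -> : p * (f + g) + (f + g) * p = (p * f + f * p) + (p * g + g * p).
      by rewrite mulrDl mulrDr addrACA.
    by rewrite mulrDl mulrDr opprD addrACA; apply: ZD.
  + by rewrite -scalerAl -scalerAr -scalerDr -scalerAl -scalerAr -scalerBr; apply: ZZ.
- by rewrite mul0r mulr0 subrr.
- by rewrite [X in X - _]mulrDr [X in _ - X]mulrDl opprD addrACA; apply: ZD.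
- by rewrite -scalerAl -scalerAr -scalerBr; apply: ZZ.
Qed.

(* The GL-ideal generated by [x_1^2, x_2]. *)
Definition square_ideal : set A := smallest (@two_sided_ideal A)
  [set g | exists p q, [/\ lin1 W p, lin1 W q & g = p * p * q - q * (p * p)]].

Lemma smallest_ideal (G : set A) : two_sided_ideal (smallest (@two_sided_ideal A) G).
Proof.
split=> [J [] [] // | a b Ha Hb J HJ | a b Hb].
  by case: (HJ) => -[_ JD _] _; apply: JD; [apply: Ha | apply: Hb].
by split=> J HJ; case: (HJ) => -[_ _ JM] _; case: (JM a b (Hb J HJ)).
Qed.

Lemma square_ideal_min (I : set A) : two_sided_ideal I ->
  (forall p q, lin1 W p -> lin1 W q -> I (p * p * q - q * (p * p))) ->
  forall f, square_ideal f -> I f.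
Proof. by move=> idI H f; apply; split=> // g [p [q [lp lq ->]]]; apply: H. Qed.

Lemma square_ideal_gen p q : lin1 W p -> lin1 W q ->
  square_ideal (p * p * q - q * (p * p)).
Proof. by move=> lp lq J [_]; apply; exists p, q. Qed.

Lemma square_ideal_stable : GL_stable W square_ideal.
Proof.
split=> [|w lw]; first exact: smallest_ideal.
apply: square_ideal_min => [|p q lp lq].
  by apply: wsub_preim_ideal; apply: smallest_ideal.
rewrite linearB !wsubM; apply: square_ideal_gen; exact: wsub_lin1.
Qed.

Lemma square_cliff (I : set A) : two_sided_ideal I ->
  (forall p q, lin1 W p -> lin1 W q -> I (p * p * q - q * (p * p))) -> cliff W I.
Proof.
move=> idI H; split=> // a b c; have l := lin1_gen W.
have := idlB idI (idlB idI (H _ _ (lin1D (l a) (l b)) (l c)) (H _ _ (l a) (l c)))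
  (H _ _ (l b) (l c)).
rewrite !(mulrDl, mulrDr, wmonM) /=; congr (I _); linear_form W.
Qed.

Lemma square_ideal_sgn m f : homog W m f -> square_ideal f -> sgn f = 0 :> K.
Proof.
move=> Hf Sf; apply: (sgn_kernel_homog Hf).
apply: square_ideal_min Sf => [|p q lp lq]; first exact: sgn_kernel_ideal.
have := sgn_kernel_lin1 lp lp lq; rewrite mulrDl mulrDr opprD addrACA -mulr2n -scaler_nat.
exact: (idlZK sgn_kernel_ideal (K0 1)).
Qed.

(* In a Clifford algebra this is [2 ^ k] times the product of the first [k]
   vectors of the Gram-Schmidt orthogonalization of the generators. *)
Fixpoint alt (k : nat) : A :=
  if k is k'.+1 then alt k' * mon [:: k'] + (-1) ^+ k' *: (mon [:: k'] * alt k')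
  else 1.

Lemma alt_homog k : homog W (iota 0 k) (alt k).
Proof.
elim: k => [|k IH]; first by rewrite /= -(wmon1 W); apply: homog_mon.
have Hk : homog W [:: k] (mon [:: k]) by exact: homog_mon.
have -> : iota 0 k.+1 = iota 0 k ++ [:: k] by rewrite -addn1 iotaD.
apply: homogD; first exact: homogM.
apply: homogZ; apply: (homog_perm (m := [:: k] ++ iota 0 k)); last exact: homogM.
by rewrite perm_catC.
Qed.

Lemma sgn_alt k : sgn (alt k) != 0 :> K.
Proof.
suff -> : sgn (alt k) = 2%:R ^+ k :> K by rewrite expf_neq0 // K0.
elim: k => [|k IH]; first by rewrite /= -(wmon1 W) sgn_mon.
have Hk : homog W [:: k] (mon [:: k]) by exact: homog_mon.
rewrite /= sgnD sgnZ (sgnM (alt_homog k) Hk) (sgnM Hk (alt_homog k)) IH sgn_mon /=.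
have -> : cross_inversions (iota 0 k) [:: k] = 0%N.
  rewrite /cross_inversions big1_seq // => a /andP[_]; rewrite mem_iota /= => ak.
  by rewrite addn0 ltnNge ltnW.
have -> : cross_inversions [:: k] (iota 0 k) = k.
  rewrite /cross_inversions big_seq1 -[RHS](size_iota 0); apply/eqP.
  by rewrite -all_count; apply/allP => a; rewrite mem_iota.
rewrite addn0 expr0 !mul1r mulr1 mulrA -expr2 sqrr_sign mul1r exprS.
by rewrite mulrDl mul1r.
Qed.

Section Clifford.
Variable I : set A.
Hypothesis cI : cliff W I.
Let idI : two_sided_ideal I := proj1 cI.

Lemma cliff_centralE a b f : I ((mon [:: a; b] + mon [:: b; a]) * f
     - f * (mon [:: a; b] + mon [:: b; a])).
Proof.
elim/(wbasis_ind (w := W)): f => [|f c u IH].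
  by rewrite mulr0 mul0r subrr; apply: idl0.
rewrite [X in X - _]mulrDr [X in _ - X]mulrDl opprD addrACA; apply: idlD => //.
by rewrite -scalerAl -scalerAr -scalerBr; apply: idlZ => //; apply: cliff_central.
Qed.

(** In the Clifford picture x_i is a combination of the k orthogonal factors of [alt k]. Each factor
    commutes with itself and anticommutes with the k-1 others, whence the sign -(-1)^k. *)
Lemma alt_supercomm k i : (i < k)%N ->
  I (alt k * mon [:: i] + (-1) ^+ k *: (mon [:: i] * alt k)).
Proof.
elim: k i => // k IH i; rewrite ltnS leq_eqVlt => /orP[/eqP -> | ik] /=.
  have /(idlZK idI (K0 1)) : I (2%:R *: (alt k * mon [:: k; k] - mon [:: k; k] * alt k)).
    have := idlN idI (cliff_centralE k k (alt k)).
    by congr (I _); rewrite mulrDl mulrDr; linear_form W.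
  congr (I _); rewrite exprS mulN1r; set e := (-1) ^+ k.
  have E2 : e * e = 1 by rewrite -expr2 sqrr_sign.
  rewrite mulrDl mulrDr -scalerAl -scalerAr -!mulrA wmonM.
  by rewrite (mulrA (mon [:: k]) (mon [:: k])) wmonM scalerDr scalerA mulNr E2; linear_form W.
have := idlD idI (idlB idI (idlN idI (cliff_centralE i k (alt k)))
   (idlMr idI (mon [:: k]) (IH i ik)))
   (idlZ idI ((-1) ^+ k) (idlMl idI (mon [:: k]) (IH i ik))).
congr (I _); rewrite exprS mulN1r; set e := (-1) ^+ k.
have E2 : e * e = 1 by rewrite -expr2 sqrr_sign.
rewrite !(mulrDl, mulrDr) -!(scalerAl, scalerAr) !scalerDr !scalerA ?mulNr E2.
have M2 a b f : mon [:: a] * (mon [:: b] * f) = mon [:: a; b] * f.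
  by rewrite mulrA wmonM.
by rewrite -!mulrA !M2 !wmonM /=; linear_form W.
Qed.

(** Raising the last letter x_j of [alt j.+1] to x_i yields exactly the expression of
    [alt_supercomm]; the other letters follow by the recursion. *)
Lemma alt_raise k i j : (i < j)%N -> I (der j i (alt k)).
Proof.
move=> ij; elim: k => [|k IH] /=; first by rewrite der1; apply: idl0.
rewrite linearD linearZ /= !derM der_gen.
have -> : der j i (alt k) * mon [:: k] + alt k * (if k == j then mon [:: i] else 0)
  + (-1) ^+ k *: ((if k == j then mon [:: i] else 0) * alt k + mon [:: k] * der j i (alt k)) =
  (der j i (alt k) * mon [:: k] + (-1) ^+ k *: (mon [:: k] * der j i (alt k))) +
  (if k == j then alt k * mon [:: i] + (-1) ^+ k *: (mon [:: i] * alt k) else 0).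
  by case: eqP => _; rewrite ?(mulr0, mul0r); linear_form W.
apply: idlD => //.
  by apply: idlD => //; [apply: idlMr | apply: idlZ => //; apply: idlMl].
by case: eqP => [kj | _]; [apply: alt_supercomm; rewrite kj | apply: idl0].
Qed.
End Clifford.
End Sign.

(** * Shapes of a GL-ideal *)

(* A partition is encoded by its boundary path [w]: each [false] is a row, whose
   length is the number of later occurrences of [true]; [shape_word k w] is the
   word [x_k^mu_1 x_(k+1)^mu_2 ...]. *)
Fixpoint shape_word (k : nat) (w : seq bool) : seq nat :=
  if w is b :: w' then
    if b then shape_word k w' else nseq (count_mem true w') k ++ shape_word k.+1 w'
  else [::].

(** The rows of [w] when it is continued by a word with [c] letters [true]; this splits a shape word
    at an insertion point. *)
Fixpoint shape_prefix (k : nat) (w : seq bool) (c : nat) : seq nat :=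
  if w is b :: w' then
    if b then shape_prefix k w' c
    else nseq (count_mem true w' + c) k ++ shape_prefix k.+1 w' c
  else [::].

Lemma shape_word_cat k w1 w2 : shape_word k (w1 ++ w2) =
  shape_prefix k w1 (count_mem true w2) ++ shape_word (k + count_mem false w1) w2.
Proof.
elim: w1 k => [|[] w1 IH] k /=; first by rewrite addn0.
  by rewrite IH.
by rewrite IH count_cat catA addSnnS.
Qed.

Lemma shape_prefix_lt k w c :
  all (fun a => a < k + count_mem false w)%N (shape_prefix k w c).
Proof.
elim: w k => [|[] w IH] k //=; rewrite ?add0n //.
rewrite all_cat all_nseq -addSnnS IH andbT; apply/orP; right; lia.
Qed.

Lemma shape_word_ge k w : all (leq k) (shape_word k w).
Proof.
elim: w k => [|[] w IH] k //=; rewrite all_cat all_nseq leqnn orbT /=.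
by apply: sub_all (IH k.+1) => a /ltnW.
Qed.

Lemma shape_word_lt w : all (fun a => a < size w)%N (shape_word 0 w).
Proof.
have -> : shape_word 0 w = shape_prefix 0 w 0.
  by rewrite -[in LHS](cats0 w) shape_word_cat cats0.
apply: sub_all (shape_prefix_lt 0 w 0) => a /leq_trans; apply.
exact: count_size.
Qed.

Lemma shape_word_succ k w : shape_word k.+1 w = map succn (shape_word k w).
Proof.
elim: w k => [|[] w IH] k //=; rewrite map_cat -IH; congr (_ ++ _).
by rewrite map_nseq.
Qed.

Lemma shape_word_sorted k w : sorted leq (shape_word k w).
Proof.
elim: w k => [|[] w IH] k //=.
have := IH k.+1; have := shape_word_ge k.+1 w.
move: (shape_word _ _) => s sk ss; elim: (count _ _) => //= c.
case: c => [|c] /=; last by rewrite leqnn.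
rewrite (path_sortedE leq_trans) ss andbT => _.
by apply: sub_all sk => a /ltnW.
Qed.

Lemma shape_word_true k w1 w2 : perm_eq (shape_word k (w1 ++ true :: w2))
  (iota k (count_mem false w1) ++ shape_word k (w1 ++ w2)).
Proof.
rewrite !shape_word_cat /= catA perm_cat2r.
elim: w1 k => [|[] w1 IH] k //=.
rewrite add0n; apply/permP => P; move/permP/(_ P): (IH k.+1).
by rewrite /= ?count_cat /= ?count_cat !count_nseq; lia.
Qed.

Lemma shape_word_count j k w : (count_mem j (shape_word k w) <= count_mem true w)%N.
Proof.
elim: w k => [|[] w IH] k //=; first by rewrite (leq_trans (IH k)) // leq_addl.
rewrite count_cat count_nseq /=; case: eqP => [<- | _].
  rewrite mul1n (count_memPn (_ : k \notin shape_word k.+1 w)) ?addn0 //; apply/negP => kw.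
  by have := allP (shape_word_ge k.+1 w) k kw; rewrite ltnn.
by rewrite mul0n; apply: IH.
Qed.

Lemma shape_word_dominant k w i j : (k <= i)%N -> (i < j)%N ->
  (count_mem j (shape_word k w) <= count_mem i (shape_word k w))%N.
Proof.
elim: w k => [|[] w IH] k //= ki ij; first exact: IH.
rewrite !count_cat !count_nseq /= (ltn_eqF (leq_ltn_trans ki ij)) mul0n add0n.
have [-> | ik] := eqVneq k i.
  by rewrite mul1n (leq_trans (shape_word_count _ _ _)) ?leq_addr.
by rewrite mul0n add0n; apply: IH => //; rewrite ltn_neqAle ik.
Qed.

Section Shapes.
Variables (K : fieldType) (A : algType K) (W : word_basis A).
Hypothesis K0 : forall n, n.+1%:R != 0 :> K.
Local Notation mon := (wmon W).
Local Notation der := (der W).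
Local Notation U := (square_ideal W).

Lemma GL_der_stable I : GL_stable W I -> der_stable W I.
Proof.
move=> GLI; have [idI _] := GLI; split.
- exact: idl0.
- exact: idlD.
- exact: idlZ.
- by move=> i j f; apply: GL_der.
Qed.

Lemma square_ideal_cliff : cliff W U.
Proof.
apply: square_cliff; first by case: (square_ideal_stable W).
by move=> p q; apply: square_ideal_gen.
Qed.

Lemma spanI_homog I k m f : cliff W I -> sorted leq m -> all (leq k) m ->
  homog W m f -> spanI W I k m (mon m) f.
Proof.
move=> cI sm km; have [idI _] := cI.
elim/homog_ind => [|f' c u pu IH]; first by apply: spanI_ideal => //; apply: idl0.
apply: spanID => //; apply: spanIZ => //.
have := spanI_sort K0 cI (k := k) (u := u); rewrite (perm_all _ pu) => /(_ km).
have -> : sort leq u = m.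
  apply: (sorted_eq leq_trans anti_leq) => //; first exact: sort_sorted leq_total _.
  by rewrite perm_sort.
by move=> [d /(lowI_perm pu) Ld]; exists d.
Qed.

(** Phrased through x^mu modulo lowering images, which suits row insertion. Column insertion needs
    an actual highest weight vector in I, obtained by [highest_weight_proj]. *)
Definition has_shape (I : set A) w :=
  lowI W I 0 (shape_word 0 w) (mon (shape_word 0 w)).

(** The vector is a product of factors [alt k], one for each column: a final [true] adds a column
    through all rows so far, a final [false] an empty row. *)
Lemma highest_weight_shape w : exists f,
  [/\ homog W (shape_word 0 w) f, forall i j, (i < j)%N -> U (der j i f)
    & sgn W f != 0 :> K].
Proof.
have idU := proj1 square_ideal_cliff.
elim/last_ind: w => [|w b [f [Hf rf sf]]].
  exists 1; rewrite -(wmon1 W); split; first exact: homog_mon.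
    by move=> i j _; rewrite (wmon1 W) der1; apply: idl0.
  by rewrite sgn_mon /= oner_neq0.
case: b; last first.
  exists f; split=> //; have -> // : shape_word 0 (rcons w false) = shape_word 0 w.
  by rewrite -cats1 -[in RHS](cats0 w) !shape_word_cat.
have pw := shape_word_true 0 w [::]; rewrite cats1 cats0 perm_sym in pw.
exists (alt W (count_mem false w) * f); split.
- by apply: (homog_perm pw); apply: homogM => //; apply: alt_homog.
- move=> i j ij; rewrite derM; apply: (idlD idU); last by apply: (idlMl idU); apply: rf.
  by apply: (idlMr idU); apply: alt_raise ij => //; apply: square_ideal_cliff.
rewrite (sgnM (alt_homog W _) Hf) !mulf_neq0 ?expf_neq0 ?oppr_eq0 ?oner_eq0 //.
exact: sgn_alt.
Qed.

Section Ideal.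
Variable I : set A.
Hypotheses (GLI : GL_stable W I) (UI : forall f, U f -> I f).
Let idI : two_sided_ideal I := proj1 GLI.

Lemma stable_cliff : cliff W I.
Proof.
apply: square_cliff => // p q lp lq; apply: UI; exact: square_ideal_gen.
Qed.

(* Adding a column of height [k]: multiply a highest weight vector of the ideal
   by [alt k]. *)
Lemma has_shape_true w1 w2 : has_shape I (w1 ++ w2) -> has_shape I (w1 ++ true :: w2).
Proof.
move=> [g Ig Lg]; set w := w1 ++ w2 in Lg *; set w' := w1 ++ true :: w2.
have idU := proj1 square_ideal_cliff.
have sU := GL_der_stable (square_ideal_stable W).
have dom v i j : (i < j)%N -> (count_mem j (shape_word 0 v) <= count_mem i (shape_word 0 v))%N.
  exact: shape_word_dominant.
have low_raise v f : homog W (shape_word 0 v) f -> lowI W U 0 (shape_word 0 v) f ->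
    (forall i j, (i < j)%N -> U (der j i f)) -> U f.
  exact: (low_raise_ideal K0 (shape_word_lt v) (dom v) sU).
have Hg : homog W (shape_word 0 w) g.
  rewrite -(subKr (mon (shape_word 0 w)) g); apply: homogB; first exact: homog_mon.
  exact: low_homog Lg.
have [v [Lv rv Iv]] := highest_weight_proj K0 (shape_word_lt w) (dom w) Hg.
have {}Iv : I v by apply: Iv => //; apply: GL_der_stable.
have Hv : homog W (shape_word 0 w) v.
  by rewrite -(subrK g v); apply: homogD => //; apply: low_homog Lv.
(* Compare [v] with the known vector [f]: some [f - c *: v] lies in U plus lowering images and its
   raised vectors lie in U, so it lies in U. Then sgn f = c sgn v, and sgn f is nonzero. *)
have sv : sgn W v != 0 :> K.
  have [f [Hf rf sf]] := highest_weight_shape w.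
  have [c Lc] := spanI_homog square_ideal_cliff (shape_word_sorted 0 w) (shape_word_ge 0 w) Hf.
  have Hfv : homog W (shape_word 0 w) (f - c *: v) by apply/homogB/homogZ.
  have Ufv : U (f - c *: v).
    apply: (low_raise w) => // [|i j ij].
      have -> : f - c *: v = (f - c *: mon (shape_word 0 w))
          + c *: ((mon (shape_word 0 w) - g) - (v - g)).
        by linear_form W.
      apply: lowID => //; apply: lowIZ => //; apply: lowI_low => //.
      by apply: lowD => //; apply: lowN.
    by rewrite linearB linearZ /= rv // scaler0 subr0; apply: rf.
  have := square_ideal_sgn K0 Hfv Ufv; rewrite linearB linearZ /= => /eqP.
  rewrite subr_eq0 => /eqP E; apply: contraNneq sf => v0.
  by rewrite E v0 scaler0.
pose F := alt W (count_mem false w1) * v.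
have HF : homog W (shape_word 0 w') F.
  apply: (homog_perm (m := iota 0 (count_mem false w1) ++ shape_word 0 w)).
    by rewrite perm_sym shape_word_true.
  by apply: homogM => //; apply: alt_homog.
have rF i j : (i < j)%N -> U (der j i F).
  move=> ij; rewrite derM rv // mulr0 addr0; apply: (idlMr idU).
  by apply: alt_raise ij => //; apply: square_ideal_cliff.
have sF : sgn W F != 0 :> K.
  rewrite (sgnM (alt_homog W _) Hv) !mulf_neq0 ?expf_neq0 ?oppr_eq0 ?oner_eq0 //.
  exact: sgn_alt.
have [c Lc] := spanI_homog square_ideal_cliff (shape_word_sorted 0 w') (shape_word_ge 0 w') HF.
(* If c were 0, then F would lie in U plus lowering images, hence in U, against sgn F != 0. *)
have c0 : c != 0.
  apply: contraNneq sF => c0; apply/eqP; apply: (square_ideal_sgn K0 HF).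
  by apply: (low_raise w') => //; move: Lc; rewrite c0 scale0r subr0.
rewrite /has_shape -/w'.
have -> : mon (shape_word 0 w') = c^-1 *: (F - (F - c *: mon (shape_word 0 w'))).
  by rewrite subKr scalerA mulVf // scale1r.
apply: lowIZ => //; apply: lowIB => //; last exact: lowI_sub Lc.
by apply: lowI_ideal; apply: idlMl.
Qed.
End Ideal.
End Shapes.

(** * Row insertion *)

Section RowInsertion.
Variables (K : fieldType) (A : algType K) (W : word_basis A).
Hypothesis K0 : forall n, n.+1%:R != 0 :> K.
Local Notation mon := (wmon W).
Local Notation der := (der W).

Section Clifford.
Variable I : set A.
Hypothesis cI : cliff W I.
Let idI : two_sided_ideal I := proj1 cI.

Lemma cliff_move_even p ys k t g :
  I (mon (p ++ ys ++ nseq t.*2 k ++ g) - mon (p ++ nseq t.*2 k ++ ys ++ g)).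
Proof.
elim: t p => [|t IH] p; first by rewrite /= subrr; apply: idl0.
have /(idlZK idI (K0 1)) : I (2%:R *: (mon (p ++ ys ++ k :: k :: nseq t.*2 k ++ g)
     - mon (p ++ k :: k :: ys ++ nseq t.*2 k ++ g))).
  have := cliff_move cI p ys k k (nseq t.*2 k ++ g).
  by congr (I _); linear_form W.
move=> I1; have := idlD idI I1 (IH (p ++ [:: k; k])).
by rewrite -!catA /= addrA subrK.
Qed.

(** Behind an even power of k the two coefficients of [der_pow] are both t+1. Hence k^(2t) (bk + kb)
    times the rest is a lowering image modulo I, and moving k past one letter b just changes the
    sign. The scalar [e] is a sign. *)
Lemma cliff_move_odd k t B C m : all (fun a => k < a)%N (B ++ C) ->
  perm_eq (nseq t.*2.+1 k ++ B ++ C) m ->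
  exists2 e : K, e != 0 & lowI W I k m
    (mon (nseq t.*2 k ++ B ++ k :: C) - e *: mon (nseq t.*2.+1 k ++ B ++ C)).
Proof.
elim/last_ind: B C => [|B b IH] C kBC pm.
  exists 1; first exact: oner_neq0.
  by rewrite /= nseqSr scale1r subrr; apply: lowI_ideal => //; apply: idl0.
rewrite cat_rcons in kBC pm.
have [e e0 Le] := IH _ kBC pm.
exists (- e); first by rewrite oppr_eq0.
rewrite !cat_rcons.
pose z := mon (nseq t.*2 k ++ b :: k :: B ++ C) + mon (nseq t.*2 k ++ k :: b :: B ++ C).
have kb : (k < b)%N by move: kBC; rewrite all_cat /= => /and3P[].
have Lz : lowI W I k m z.
  have kBC' : k \notin B ++ C.
    apply/negP => kin; have := allP kBC k; rewrite ltnn mem_cat inE orbCA.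
    by rewrite -mem_cat kin orbT => /(_ isT).
  have I1 := idlMr idI (mon (B ++ C)) (der_pow K0 cI k b t.*2).
  rewrite mulrBl mulrDl -!scalerAl !wmonM -!catA /= in I1.
  have h0 : t.+1%:R != 0 :> K by exact: K0.
  have -> : z = t.+1%:R^-1 *: (der k b (mon (nseq t.*2.+2 k ++ B ++ C))
     - (der k b (mon (nseq t.*2.+2 k)) * mon (B ++ C)
        - t.+1%:R *: mon (nseq t.*2.+1 k ++ b :: B ++ C)
        - t.+1%:R *: mon (nseq t.*2 k ++ b :: k :: B ++ C))).
    rewrite -[mon (nseq t.*2.+2 k ++ B ++ C)]wmonM derM (der_notin W b kBC') mulr0 addr0.
    rewrite -nseqSr -/(z); set y := der _ _ _ * _.
    rewrite -[RHS]scale1r.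
    have -> : y - (y - t.+1%:R *: mon (nseq t.*2 k ++ [:: k, b & B ++ C])
       - t.+1%:R *: mon (nseq t.*2 k ++ [:: b, k & B ++ C])) = t.+1%:R *: z.
      by rewrite /z; linear_form W.
    by rewrite scale1r scalerA mulVf // scale1r.
  apply: lowIZ => //; apply: lowIB => //.
    apply: lowI_low => //; apply: low_der => //.
    by perm_lia pm.
  apply: lowI_ideal; move: I1; rewrite /= !doubleK uphalf_double.
  by congr (I _); linear_form W.
have I2 := cliff_move cI (nseq t.*2 k) B b k C.
have -> : mon (nseq t.*2 k ++ B ++ b :: k :: C) - - e *: mon (nseq t.*2.+1 k ++ B ++ b :: C)
  = (mon (nseq t.*2 k ++ B ++ [:: b, k & C]) + mon (nseq t.*2 k ++ B ++ [:: k, b & C]) - z)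
    + z - (mon (nseq t.*2 k ++ B ++ k :: b :: C) - e *: mon (nseq t.*2.+1 k ++ B ++ b :: C)).
  by linear_form W.
by apply: lowIB => //; apply: lowID => //; apply: lowI_ideal.
Qed.

Lemma cliff_move_row k p B : all (fun a => k < a)%N B ->
  exists2 e : K, e != 0 & lowI W I k (nseq p k ++ B)
    (mon (B ++ nseq p k) - e *: mon (nseq p k ++ B)).
Proof.
move=> kB; rewrite -(odd_double_half p); move: (p./2) => t.
have E := cliff_move_even [::] B k t; rewrite /= in E.
case: (odd p); rewrite ?add0n ?add1n.
  have kB0 : all (fun a => k < a)%N (B ++ [::]) by rewrite cats0.
  have [|e e0 Le] := cliff_move_odd (m := nseq t.*2.+1 k ++ B) (t := t) kB0.
    by rewrite cats0.
  exists e => //; have := E [:: k]; rewrite nseqSr !cats0 in Le * => E1.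
  have -> : mon (B ++ nseq t.*2.+1 k) - e *: mon (nseq t.*2.+1 k ++ B) =
    (mon (B ++ nseq t.*2.+1 k) - mon (nseq t.*2 k ++ B ++ [:: k])) +
    (mon (nseq t.*2 k ++ B ++ [:: k]) - e *: mon (nseq t.*2.+1 k ++ B)).
    by linear_form W.
  by apply: lowID => //; apply: lowI_ideal.
exists 1; first exact: oner_neq0.
by rewrite scale1r; apply: lowI_ideal => //; have := E [::]; rewrite !cats0.
Qed.
End Clifford.

Lemma wsub_rename (h : nat -> nat) u :
  wsub W (fun a => mon [:: h a]) (mon u) = mon (map h u).
Proof.
rewrite wsub_mon; elim: u => [|a u IH]; first by rewrite big_nil (wmon1 W).
by rewrite big_cons IH wmonM.
Qed.

Lemma wsub_rename_der (h : nat -> nat) i j v : injective h ->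
  wsub W (fun a => mon [:: h a]) (der i j (mon v)) =
  der (h i) (h j) (mon (map h v)).
Proof.
move=> h_inj; elim: v => [|a v IH]; first by rewrite /= (wmon1 W) !der1 linear0.
rewrite /= !der_cons linearD wsubM IH wsub_rename (inj_eq h_inj); congr (_ + _).
by case: eqP => _; rewrite ?linear0 // wsub_rename.
Qed.

Lemma low_insert k p m f : low W 0 m f ->
  low W 0 (map (bump k) m ++ nseq p k)
    (wsub W (fun a => mon [:: bump k a]) f * mon (nseq p k)).
Proof.
elim=> [|g c i j v _ IH _ ij pv]; first by rewrite linear0 mul0r; apply: low0.
rewrite linearD linearZ /= mulrDl -scalerAl.
have bump_inj : injective (bump k) := can_inj (bumpK k).
rewrite wsub_rename_der //.
have -> : der (bump k i) (bump k j) (mon (map (bump k) v)) * mon (nseq p k) =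
    der (bump k i) (bump k j) (mon (map (bump k) v ++ nseq p k)).
  rewrite -wmonM derM [X in _ = _ + _ * X]der_notin ?mulr0 ?addr0 //.
  by rewrite mem_nseq eq_sym (negPf (neq_bump _ _)) andbF.
apply: low_add => //; first by rewrite ltnNge leq_bump2 -ltnNge.
by have := perm_map (bump k) pv; move=> /= H; perm_lia H.
Qed.

Section Ideal.
Variable I : set A.
Hypotheses (GLI : GL_stable W I) (UI : forall f, square_ideal W f -> I f).
Let idI : two_sided_ideal I := proj1 GLI.

(* Inserting a row: the new variable, placed at the end of the word, commutes
   with all the lowering operators involved, and is then moved into position. *)
Lemma has_shape_false w1 w2 :
  has_shape W I (w1 ++ w2) -> has_shape W I (w1 ++ false :: w2).
Proof.
rewrite /has_shape !shape_word_cat /= add0n shape_word_succ.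
(* [k] is the index of the new row and [c] its length. The rows before it form P and stay; those
   after it, B, have their indices shifted by one. *)
set k := count_mem false w1; set c := count_mem true w2.
have := shape_prefix_lt 0 w1 c; rewrite add0n -/k.
have := shape_word_ge k w2.
move: (shape_prefix _ _ _) (shape_word _ _) => P B kB Pk [g Ig Lg].
have EP : map (bump k) P = P.
  apply: map_id_in => a aP; rewrite /bump leqNgt (allP Pk a aP) //.
have EB : map (bump k) B = map succn B.
  by apply/eq_in_map => a aB; rewrite /bump (allP kB a aB).
have [|e e0 Le] := cliff_move_row (stable_cliff GLI UI) c (k := k) (B := map succn B).
  by apply/allP => _ /mapP[a aB ->]; rewrite ltnS (allP kB a aB).
have /(lowI_le (leq0n k)) L1 := lowIMl idI Pk Le.
have := low_insert k c Lg; rewrite linearB wsub_rename mulrBl wmonM !map_cat EP EB.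
rewrite -catA => L2.
have -> : mon (P ++ nseq c k ++ map succn B) =
    e^-1 *: (mon (P ++ map succn B ++ nseq c k)
      - mon P * (mon (map succn B ++ nseq c k) - e *: mon (nseq c k ++ map succn B))).
  by rewrite mulrBr -scalerAr !wmonM subKr scalerA mulVf // scale1r.
apply: lowIZ => //; apply: lowIB => //.
apply: (lowI_perm (m := P ++ map succn B ++ nseq c k)).
  by rewrite perm_cat2l perm_catC.
exists (wsub W (fun a => mon [:: bump k a]) g * mon (nseq c k)); last exact: L2.
apply: idlMr => //; apply: (proj2 GLI) => // a; exact: lin1_gen.
Qed.

Lemma has_shape_subseq w w' : subseq w w' -> has_shape W I w -> has_shape W I w'.
Proof.
(* The prefix [p] collects the letters already matched or inserted, since insertions occur at any
   position. *)
suff H p : subseq w w' -> has_shape W I (p ++ w) -> has_shape W I (p ++ w').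
  exact: (H [::]).
elim: w' w p => [|b w' IH] [|a w] p //= sub Hw.
- have := IH [::] (rcons p b) (sub0seq _); rewrite !cat_rcons; apply.
  by case: b; [apply: has_shape_true | apply: has_shape_false].
- have [E | ab] := eqVneq a b.
    by rewrite E eqxx in sub Hw; rewrite -cat_rcons; apply: (IH w) => //; rewrite cat_rcons.
  rewrite (negPf ab) in sub; rewrite -cat_rcons; apply: (IH (a :: w)) => //.
  rewrite cat_rcons.
  by case: b {ab}; [apply: has_shape_true | apply: has_shape_false].
Qed.
End Ideal.
End RowInsertion.

(** * Higman's lemma for binary words *)

(** The finite basis form of the well-quasi-order property, for all subsets of S, so that no
    infinite sequences are needed. *)
Definition finitely_based (S : seq bool -> Prop) :=
  forall T : seq bool -> Prop, (forall w, T w -> S w) ->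
  exists B : seq (seq bool), (forall b, b \in B -> T b) /\
    forall w, T w -> exists2 b, b \in B & subseq b w.

(** Choose a level for each member of a finite basis of the projection of R to words, and let M be
    the largest. These pairs cover every level from M on, and each of the finitely many lower levels
    has a finite basis of its own. *)
Lemma finitely_based_prod (S : seq bool -> Prop) (R : nat -> seq bool -> Prop) :
  finitely_based S -> (forall n q, R n q -> S q) ->
  exists B : seq (nat * seq bool), (forall p, p \in B -> R p.1 p.2) /\
    forall n q, R n q -> exists2 p, p \in B & (p.1 <= n)%N && subseq p.2 q.
Proof.
move=> FS RS.
have [B [BT TB]] := FS (fun q => exists n, R n q) (fun q '(ex_intro n Rnq) => RS n q Rnq).
have [B1 [B1R BB1]] : exists B1 : seq (nat * seq bool),
    (forall p, p \in B1 -> R p.1 p.2) /\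
    forall q, q \in B -> exists n, (n, q) \in B1.
  elim: B {TB} BT => [|q B IH] BT; first by exists [::].
  have [r rB|B1 [B1R BB1]] := IH; first by apply: BT; rewrite inE rB orbT.
  have [n Rnq] := BT q (mem_head _ _); exists ((n, q) :: B1); split.
    by move=> p; rewrite inE => /orP[/eqP -> | /B1R].
  move=> r; rewrite inE => /orP[/eqP -> | /BB1[k kB]].
    by exists n; rewrite mem_head.
  by exists k; rewrite inE kB orbT.
pose M := (\max_(p <- B1) p.1)%N.
have [B2 [B2R B2B]] : exists B2 : seq (nat * seq bool),
    (forall p, p \in B2 -> R p.1 p.2) /\
    forall n q, (n < M)%N -> R n q ->
      exists2 p, p \in B2 & (p.1 <= n)%N && subseq p.2 q.
  elim: M => [|M [B2 [B2R B2B]]]; first by exists [::].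
  have [C [CT TC]] := FS (R M) (RS M).
  exists ([seq (M, q) | q <- C] ++ B2); split.
    by move=> p; rewrite mem_cat => /orP[/mapP[q qC ->] | /B2R //]; apply: CT.
  move=> n q; rewrite ltnS leq_eqVlt => /orP[/eqP -> | nM] Rnq.
    have [c cC cq] := TC q Rnq; exists (M, c); last by rewrite /= leqnn.
    by rewrite mem_cat map_f.
  have [p pB Hp] := B2B n q nM Rnq; exists p => //.
  by rewrite mem_cat pB orbT.
exists (B1 ++ B2); split=> [p | n q Rnq].
  by rewrite mem_cat => /orP[/B1R | /B2R].
have [nM | Mn] := ltnP n M.
  by have [p pB Hp] := B2B n q nM Rnq; exists p => //; rewrite mem_cat pB orbT.
have [b bB bq] := TB q (ex_intro _ n Rnq); have [k kB] := BB1 b bB.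
exists (k, b); first by rewrite mem_cat kB.
rewrite /= bq andbT; apply: leq_trans Mn; rewrite /M.
by apply: (@leq_bigmax_seq _ _ xpredT fst (k, b)).
Qed.

Lemma notin_nseq (a : bool) w : a \notin w -> w = nseq (size w) (~~ a).
Proof.
elim: w => //= b w IH; rewrite inE negb_or => /andP[ab /IH <-].
by case: a b ab {IH} => [] [].
Qed.

Lemma in_split_first (a : bool) w : a \in w ->
  exists n q, w = nseq n (~~ a) ++ a :: q.
Proof.
elim: w => //= b w IH; rewrite inE; have [<- _ | ab /= /IH[n [q ->]]] := eqVneq a b.
  by exists 0, w.
by exists n.+1, q; case: a b ab {IH} => [] [].
Qed.

Lemma subseq_nseq_cat (b : bool) n n' s s' : (n <= n')%N -> subseq s s' ->
  subseq (nseq n b ++ s) (nseq n' b ++ s').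
Proof.
move=> nn' ss'; rewrite -(subnK nn') nseqD -catA.
apply: subseq_trans (suffix_subseq _ _).
by elim: n {nn'} => //= n IH; rewrite eqxx.
Qed.

(* A word avoiding [a :: z] is [nseq n (~~ a) ++ a :: q] with [q] avoiding [z],
   or has no letter [a]. *)
Lemma finitely_based_avoid z : finitely_based (fun w => ~~ subseq z w).
Proof.
elim: z => [|a z IH] T TS.
  by exists [::]; split=> // w /TS; rewrite sub0seq.
have [|B [BR RB]] := finitely_based_prod (R := fun n q => T (nseq n (~~ a) ++ a :: q)) IH.
  move=> n q /TS; apply: contraNN => zq.
  by apply: (@subseq_nseq_cat _ 0 n (a :: z)) => //=; rewrite eqxx.
(* The words without [a] form a chain, so the shortest one in T suffices; if there is none, [n0] is
   arbitrary. *)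
have [n0 Hn0] : exists n0, forall n, T (nseq n (~~ a)) -> (n0 <= n)%N /\ T (nseq n0 (~~ a)).
  have [[n Tn] | noT] := pselect (exists n, T (nseq n (~~ a))); last first.
    by exists 0 => n Tn; case: noT; exists n.
  have ex : exists n, `[< T (nseq n (~~ a)) >] by exists n; apply/asboolP.
  exists (ex_minn ex) => k Tk; case: ex_minnP => k0 /asboolP Tk0 mink0.
  by split=> //; apply: mink0; apply/asboolP.
have [C [CT TC]] : exists C : seq (seq bool), (forall b, b \in C -> T b) /\
    forall n, T (nseq n (~~ a)) -> exists2 b, b \in C & subseq b (nseq n (~~ a)).
  have [T0 | nT0] := pselect (T (nseq n0 (~~ a))); last first.
    by exists [::]; split=> // n /Hn0[_ /nT0].
  exists [:: nseq n0 (~~ a)]; split=> [b | n /Hn0[le_n _]].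
    by rewrite inE => /eqP ->.
  exists (nseq n0 (~~ a)); first exact: mem_head.
  by rewrite -[nseq n0 _]cats0 -[nseq n _]cats0; apply: subseq_nseq_cat.
exists (C ++ [seq nseq p.1 (~~ a) ++ a :: p.2 | p <- B]); split=> [b | w Tw].
  by rewrite mem_cat => /orP[/CT // | /mapP[p pB ->]]; apply: BR.
have [aw | naw] := boolP (a \in w); last first.
  rewrite (notin_nseq naw) in Tw *; have [b bC bw] := TC _ Tw.
  by exists b => //; rewrite mem_cat bC.
have [n [q Ew]] := in_split_first aw; rewrite Ew in Tw *.
have [p pB /andP[pn pq]] := RB n q Tw.
exists (nseq p.1 (~~ a) ++ a :: p.2).
  rewrite mem_cat; apply/orP; right.
  by apply: (map_f (fun p => nseq p.1 (~~ a) ++ a :: p.2)).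
by apply: subseq_nseq_cat => //=; rewrite eqxx.
Qed.

(** Fix one z in T: it covers the words above it, and the others avoid z. *)
Lemma higman_bool : finitely_based (fun=> True).
Proof.
move=> T _; have [[z Tz] | noT] := pselect (exists z, T z); last first.
  by exists [::]; split=> // w Tw; case: noT; exists w.
have [B [BT TB]] := finitely_based_avoid (z := z) (T := fun w => T w /\ ~~ subseq z w)
  (fun w Tw => proj2 Tw).
exists (z :: B); split=> [b | w Tw].
  by rewrite inE => /orP[/eqP -> // | /BT[]].
have [zw | nzw] := boolP (subseq z w); first by exists z => //; apply: mem_head.
by have [b bB bw] := TB w (conj Tw nzw); exists b => //; rewrite inE bB orbT.
Qed.

Lemma dominant_shape m :
  (forall i j, (i < j)%N -> (count_mem j m <= count_mem i m)%N) ->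
  exists w, perm_eq m (shape_word 0 w).
Proof.
move=> dom; pose c i := count_mem i m.
(* Row k is followed by as many [true] as it is longer than row k+1. Taking [(sumn m).+1] rows
   reaches past every letter of m. *)
pose fix path k r := if r is r'.+1 then
  false :: nseq (c k - c k.+1) true ++ path k.+1 r' else nseq (c k) true.
have path_true k r : count_mem true (path k r) = c k.
  elim: r k => [|r IH] k /=; first by rewrite count_nseq mul1n.
  by rewrite count_cat count_nseq IH mul1n add0n subnK // dom.
have nseq_true k n w : shape_word k (nseq n true ++ w) = shape_word k w by elim: n.
have path_count a k r : count_mem a (shape_word k (path k r)) =
    if (k <= a < k + r)%N then c a else 0.
  elim: r k => [|r IH] k /=.
    rewrite -[nseq _ _]cats0 nseq_true /= addn0.
    by case: ifP => // /andP[/leq_ltn_trans h /h]; rewrite ltnn.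
  have -> : count_mem true (nseq (c k - c k.+1) true ++ path k.+1 r) = c k.
    exact: (path_true k r.+1).
  rewrite nseq_true count_cat count_nseq IH /= addSnnS.
  by have [-> | ka] := eqVneq k a; case: ifP; case: ifP; lia.
exists (path 0 (sumn m).+1); apply/allP => a _; apply/eqP.
rewrite [RHS]path_count leq0n add0n.
case: ltnP => //= am; apply/count_memPn.
apply/negP => /perm_to_rem/perm_sumn /= E; move: am; rewrite E; lia.
Qed.

(** * Finite generation *)

Section Finiteness.
Variables (K : fieldType) (A : algType K) (W : word_basis A).
Hypothesis K0 : forall n, n.+1%:R != 0 :> K.
Local Notation mon := (wmon W).
Local Notation der := (der W).
Local Notation U := (square_ideal W).

Lemma hcomp_sum f : exists ms : seq (seq nat), f = \sum_(m <- ms) hcomp W m f.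
Proof.
(* Sorted words represent each multidegree once, so no component is counted twice. *)
suff [L [sL HL]] : exists L : seq (seq nat), all (sorted leq) L /\
    forall L', uniq L' -> {subset L <= L'} -> all (sorted leq) L' ->
    f = \sum_(m <- L') hcomp W m f.
  exists (undup L); apply: HL; first exact: undup_uniq.
    by move=> x; rewrite mem_undup.
  by apply/allP => x; rewrite mem_undup; apply: (allP sL).
elim/(wbasis_ind (w := W)): f => [|f c u [L [sL IH]]].
  by exists [::]; split=> // L' _ _ _; rewrite big1 // => m _; rewrite linear0.
have su : sorted leq (sort leq u) := sort_sorted leq_total u.
exists (sort leq u :: L); split=> [|L' uL' sub sL']; first by rewrite /= su.
rewrite [in LHS](IH L') // => [|x xL]; last by apply: sub; rewrite inE xL orbT.
have Eu : mon u = \sum_(m <- L') hcomp W m (mon u).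
  have uin : sort leq u \in L' by apply: sub; rewrite inE eqxx.
  rewrite (bigD1_seq (sort leq u)) //= hcomp_mon perm_sym perm_sort perm_refl.
  rewrite big1_seq ?addr0 // => m /andP[mu mL'].
  rewrite hcomp_mon; case: ifP => // um; case/eqP: mu.
  apply: (sorted_eq leq_trans anti_leq) => //; first exact: (allP sL').
  by rewrite perm_sym perm_sort.
rewrite [X in _ + c *: X]Eu scaler_sumr -big_split /=; apply: eq_bigr => m _.
by rewrite [RHS]linearD [X in _ = _ + X]linearZ.
Qed.

Definition swap_letters (i j a : nat) := if a == i then j else if a == j then i else a.

Lemma swap_lettersK i j : involutive (swap_letters i j).
Proof.
move=> a; rewrite /swap_letters.
have [-> | ai] := eqVneq a i; first by rewrite eqxx; case: eqVneq.
have [-> | aj] := eqVneq a j; first by rewrite eqxx.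
by rewrite (negPf ai) (negPf aj).
Qed.

Lemma sumn_swap i j m : (i < j)%N ->
  (sumn (map (swap_letters i j) m) + count_mem j m * (j - i) =
   sumn m + count_mem i m * (j - i))%N.
Proof.
move=> ij; have d : (j = i + (j - i))%N by rewrite subnKC // ltnW.
elim: m => //= a m; rewrite [swap_letters i j a]/swap_letters !mulnDl.
move: (sumn _) (_ m * _)%N (_ m * _)%N => s x y IH.
have [-> | ai] := eqVneq a i; first by rewrite (ltn_eqF ij) mul1n mul0n; lia.
by have [-> | aj] := eqVneq a j; rewrite ?mul1n ?mul0n; lia.
Qed.

Lemma homog_rename h m f : homog W m f ->
  homog W (map h m) (wsub W (fun a => mon [:: h a]) f).
Proof.
elim/homog_ind => [|f' c u pu IH]; first by rewrite linear0; apply: homog0.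
rewrite linearD linearZ /= wsub_rename; apply/homogD/homogZ/homog_mon => //.
exact: perm_map.
Qed.

(** Generation of I by U and H is expressed by quantifying over all stable J, which avoids
    constructing the generated ideal here. *)
Theorem GL_stable_finite I : GL_stable W I -> (forall f, U f -> I f) ->
  exists H : seq A, (forall h, h \in H -> I h) /\
    forall J, GL_stable W J -> (forall f, U f -> J f) ->
      (forall h, h \in H -> J h) -> forall f, I f -> J f.
Proof.
move=> GLI UI; have idU := proj1 (square_ideal_stable W).
have [B [BI IB]] := higman_bool (T := has_shape W I) (fun _ _ => Logic.I).
have [H [HI BH]] : exists H : seq A, (forall h, h \in H -> I h) /\
    forall b, b \in B -> exists2 h, h \in H &
      low W 0 (shape_word 0 b) (mon (shape_word 0 b) - h).
  elim: B BI {IB} => [|b B IH] BI; first by exists [::].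
  have [c cB|H [HI BH]] := IH; first by apply: BI; rewrite inE cB orbT.
  have [g Ig Lg] := BI b (mem_head _ _); exists (g :: H); split=> [h | c].
    by rewrite inE => /orP[/eqP -> | /HI].
  rewrite inE => /orP[/eqP -> | /BH[h hH Lh]]; first by exists g; rewrite ?mem_head.
  by exists h; rewrite ?inE ?hH ?orbT.
exists H; split=> // J GLJ UJ HJ.
have [idJ subJ] := GLJ; have [idI subI] := GLI.
have shapeIJ w : has_shape W I w -> has_shape W J w.
  move=> /IB[b bB bw]; apply: has_shape_subseq bw _ => //.
  by have [h hH Lh] := BH b bB; exists h => //; apply: HJ.
have homogIJ m f : homog W m f -> I f -> J f.
  (* Multidegrees are ordered by the sum of their letters. Raising decreases it, and so does
     swapping two letters that violate dominance; therefore only dominant multidegrees need an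
     argument. *)
  have [n] := ubnP (sumn m); elim: n m f => // n IH m f lt_n Hf If.
  have [[i [j [ij cij]]] | ndom] :=
      pselect (exists i j, (i < j)%N /\ (count_mem i m < count_mem j m)%N).
    pose w a := mon [:: swap_letters i j a].
    have lw a : lin1 W (w a) by exact: lin1_gen.
    have -> : f = wsub W w (wsub W w f).
      rewrite wsub_comp; have -> : wsub W w \o w = fun a => mon [:: a].
        by apply/funext => a /=; rewrite wsub_rename /= swap_lettersK.
      apply: (lin_ext (W := W) (F := idfun) (G := wsub W _)) => u.
      by rewrite (wsub_rename W id) map_id.
    apply: subJ => //; apply: (IH (map (swap_letters i j) m)).
    - have := sumn_swap m ij.
      have : (count_mem i m * (j - i) < count_mem j m * (j - i))%N.
        by rewrite ltn_pmul2r // subn_gt0.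
      by move: lt_n; lia.
    - exact: homog_rename.
    - exact: subI.
  have dom i j : (i < j)%N -> (count_mem j m <= count_mem i m)%N.
    move=> ij; rewrite leqNgt; apply/negP => cij.
    by apply: ndom; exists i, j.
  have raiseJ i j : (i < j)%N -> J (der j i f).
    move=> ij; have [jm | jm] := boolP (j \in m); last first.
      by rewrite (der_homog_notin i Hf jm); apply: idl0.
    apply: (IH (i :: rem j m)); last exact: GL_der.
      by move: lt_n; rewrite (perm_sumn (perm_to_rem jm)) /=; lia.
    by apply: der_homog Hf; perm_lia (perm_to_rem jm).
  have mlt : all (fun a => a < (sumn m).+1)%N m.
    by apply/allP => a /perm_to_rem/perm_sumn /= ->; rewrite ltnS leq_addr.
  have closeJ := low_raise_ideal K0 mlt dom (GL_der_stable K0 GLJ) Hf.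
  apply: closeJ raiseJ.
  have [w pw] := dominant_shape dom; set m0 := shape_word 0 w in pw *.
  have Hf0 := homog_perm pw Hf.
  have [c Lc] := spanI_homog K0 (square_ideal_cliff W) (shape_word_sorted 0 w)
                   (shape_word_ge 0 w) Hf0.
  rewrite -/m0 in Lc.
  have {}pw : perm_eq m0 m by rewrite perm_sym.
  have LJ : lowI W J 0 m (f - c *: mon m0) by apply: lowI_perm pw _; apply: lowI_sub Lc.
  (* If c != 0, then x^mu itself lies in I plus lowering images, so mu is a shape of I and hence of
     J. *)
  have [c0 | c0] := eqVneq c 0; first by move: LJ; rewrite c0 scale0r subr0.
  rewrite -(subrK (c *: mon m0) f); apply: lowID => //; apply: lowIZ => //.
  apply: (lowI_perm pw); apply: shapeIJ; rewrite /has_shape -/m0.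
  have -> : mon m0 = c^-1 *: (f - (f - c *: mon m0)).
    by rewrite subKr scalerA mulVf // scale1r.
  apply: lowIZ => //; apply: lowIB => //; last exact: lowI_sub Lc.
  exact: lowI_ideal.
move=> f If; have [ms ->] := hcomp_sum f; apply: idl_sum => // m _.
apply: (homogIJ m); first exact: hcomp_homog.
exact: GL_hcomp.
Qed.
End Finiteness.

(** * The free algebra *)

Section FreeAlgInstance.
Variable K : fieldType.

(* The library makes [{malg K[M]}] an [algType] only for commutative [M]. *)
Definition free_alg := freeAlg K.
HB.instance Definition _ := GRing.Lalgebra.on free_alg.

Lemma free_alg_scaleAr (c : K) (f g : free_alg) : c *: (f * g) = f * (c *: g).
Proof.
have central : f * malgC c = c *: f.
  rewrite malgM_def malgZ_def fgmulgU; apply: eq_bigr => k _.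
  by rewrite mulm1 mulrC.
rewrite scalerAl -central -mulrA; congr (_ * _); exact: mul_malgC.
Qed.

HB.instance Definition _ :=
  GRing.Lalgebra_isAlgebra.Build K free_alg free_alg_scaleAr.

Definition word (u : seq nat) : free_alg := << FMonom u >>.

Definition word_ext (V : lmodType K) (h : seq nat -> V) (f : free_alg) : V :=
  \sum_(k <- msupp (f : freeAlg K)) (f : freeAlg K)@_k *: h k.

Lemma word_extEw (V : lmodType K) (h : seq nat -> V) (d : {fset {fmonom nat}})
    (f : freeAlg K) :
  fsubset (msupp f) d -> word_ext h f = \sum_(k <- d) f@_k *: h k.
Proof.
move=> le; rewrite /word_ext (big_fset_incl _ le) //= => x _ /mcoeff_outdom ->.
by rewrite scale0r.
Qed.

Lemma word_ext_linear (V : lmodType K) (h : seq nat -> V) : linear (word_ext h).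
Proof.
move=> a f g.
pose d := fsetU (msupp (f : freeAlg K)) (fsetU (msupp (g : freeAlg K))
            (msupp (a *: (f : freeAlg K) + g))).
have sf : fsubset (msupp (f : freeAlg K)) d by exact: fsubsetUl.
have sg : fsubset (msupp (g : freeAlg K)) d.
  by apply: fsubset_trans (fsubsetUr _ _); exact: fsubsetUl.
have sfg : fsubset (msupp (a *: (f : freeAlg K) + g)) d.
  by apply: fsubset_trans (fsubsetUr _ _); exact: fsubsetUr.
rewrite (word_extEw h sf) (word_extEw h sg) (word_extEw h sfg).
rewrite scaler_sumr -big_split /=.
by apply: eq_bigr => k _; rewrite mcoeffD mcoeffZ scalerDl scalerA.
Qed.

HB.instance Definition _ (V : lmodType K) (h : seq nat -> V) :=
  GRing.isLinear.Build K free_alg V _ (word_ext h) (word_ext_linear h).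

Lemma word_ext_word (V : lmodType K) (h : seq nat -> V) u : word_ext h (word u) = h u.
Proof.
rewrite (word_extEw h (d := fset1 (FMonom u))) ?msuppU_le //.
by rewrite big_seq_fset1 mcoeffUU scale1r.
Qed.

Lemma wordE (f : freeAlg K) : f = \sum_(k <- msupp f) f@_k *: (word k : freeAlg K).
Proof.
rewrite [LHS]monalgE; apply: eq_bigr => k _.
by rewrite -mul_malgC /word fmK malgM_def fgmulUU mulr1 mul1m.
Qed.

Lemma word_ind (P : free_alg -> Prop) :
  P 0 -> (forall f c u, P f -> P (f + c *: word u)) -> forall f, P f.
Proof.
move=> P0 PD f; rewrite [f]wordE; elim: (enum_fset _) => [|k s IH].
  by rewrite big_nil.
by rewrite big_cons addrC; apply: PD.
Qed.

Lemma word_nil : word [::] = 1.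
Proof. by rewrite /word -fmoneE. Qed.

Lemma word_cat u v : word u * word v = word (u ++ v).
Proof.
rewrite /word /GRing.mul /= fgmulUU mulr1; congr (mkmalgU _ _); exact: fmmulE.
Qed.

Definition free_basis : word_basis free_alg := WordBasis
  (fun V h => word_ext_word h) word_ind word_nil word_cat.

Lemma gen_word i : gen K i = word [:: i].
Proof. by rewrite /gen fmuE. Qed.

Lemma word_catE u v : (word u : freeAlg K) * (word v : freeAlg K) = word (u ++ v).
Proof. exact: word_cat. Qed.

Lemma free_basis_gen i : wmon free_basis [:: i] = gen K i.
Proof. by rewrite gen_word. Qed.

Lemma subst_wsub w (f : freeAlg K) : subst w f = wsub free_basis w f.
Proof. by apply: eq_bigr => k _; rewrite mul_malgC. Qed.

Lemma spX_lin1 (w : freeAlg K) : spX w <-> lin1 free_basis w.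
Proof.
by split=> -[n [c ->]]; exists n, c; apply: eq_bigr => i _; rewrite free_basis_gen.
Qed.

(** The preimage of the ideal under a linear substitution is an ideal, and it contains the
    generators because linear substitutions compose. *)
Lemma GL_ideal_gen_stable (H : set (freeAlg K)) :
  GL_stable free_basis (GL_ideal_gen H).
Proof.
split=> [|w lw f]; first exact: smallest_ideal.
pose J : set free_alg := fun g => GL_ideal_gen H (wsub free_basis w g).
apply: (_ : GL_ideal_gen H f -> J f) => HF; apply: HF; split.
  by apply: wsub_preim_ideal; apply: smallest_ideal.
move=> _ [h [v [Hh sv ->]]]; rewrite /J subst_wsub wsub_comp => G [_]; apply.
have swv i : spX ((wsub free_basis w \o v) i).
  exact: (proj2 (spX_lin1 _) (wsub_lin1 lw (proj1 (spX_lin1 _) (sv i)))).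
exists h, (wsub free_basis w \o v); split; [exact: Hh | exact: swv |].
by rewrite subst_wsub.
Qed.

Lemma GL_ideal_gen_sub (H : set (freeAlg K)) h : H h -> GL_ideal_gen H h.
Proof.
move=> Hh G [_]; apply; have sg i : spX (gen K i).
  by rewrite -free_basis_gen; exact: (proj2 (spX_lin1 _) (lin1_gen free_basis i)).
exists h, (gen K); split; [exact: Hh | exact: sg |].
rewrite subst_wsub.
apply: (lin_ext (W := free_basis) (F := idfun) (G := wsub _ _)) => u.
rewrite wsub_mon /=; elim: u => [|a u IH]; first by rewrite big_nil word_nil.
by rewrite big_cons -IH -free_basis_gen [RHS]word_cat.
Qed.

Lemma GL_ideal_gen_min (H : set (freeAlg K)) (I : set (freeAlg K)) :
  GL_stable free_basis I -> (forall h, H h -> I h) ->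
  forall f, GL_ideal_gen H f -> I f.
Proof.
move=> [idI subI] HI f; apply; split=> // _ [h [w [Hh sw ->]]].
have lw i := proj1 (spX_lin1 _) (sw i).
by rewrite subst_wsub; apply: (subI w lw); apply: HI.
Qed.

Lemma square_ideal_sub (I : set (freeAlg K)) : GL_stable free_basis I ->
  I (commutator (gen K 0 ^+ 2) (gen K 1)) ->
  forall f, square_ideal free_basis f -> I f.
Proof.
move=> [idI subI] Ic; apply: (square_ideal_min idI) => p q lp lq.
pose w i := if i is 0%N then p else q.
have lw i : lin1 free_basis (w i) by case: i.
have E : commutator (gen K 0 ^+ 2) (gen K 1) =
    (word [:: 0; 0; 1] : freeAlg K) - (word [:: 1; 0; 0] : freeAlg K).
  by rewrite /commutator expr2 !gen_word !word_catE.
rewrite E in Ic.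
have /(subI w lw) : I (wmon free_basis [:: 0; 0; 1] - wmon free_basis [:: 1; 0; 0]).
  exact: Ic.
rewrite linearB !wsub_mon !big_cons big_nil !mulr1 mulrA; exact.
Qed.
End FreeAlgInstance.

Theorem theorem2 (K : fieldType) (charK0 : [pchar K] =i pred0)
    (I : set (freeAlg K)) (GLI : GL_ideal I)
    (commI : I (commutator (gen K 0 ^+ 2) (gen K 1))) :
  fin_gen_GL_ideal I.
Proof.
have K0 n : n.+1%:R != 0 :> K by rewrite (proj1 (pcharf0P K) charK0).
have {GLI} stI : GL_stable (free_basis K) I.
  by case: GLI => H ->; apply: GL_ideal_gen_stable.
have [H [HI genI]] := GL_stable_finite K0 stI (square_ideal_sub stI commI).
set c := commutator _ _ in commI.
(* [H] generates I only together with U, so the commutator, whose substitution instances generate U,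
   joins the generators. *)
exists [set` c :: H]%classic; split; first exact: finite_seq.
have cH h : (h \in c :: H) -> I h.
  by rewrite inE => /orP[/eqP -> // | /HI].
apply/seteqP; split=> f.
  apply: genI => [||h hH].
  - exact: GL_ideal_gen_stable.
  - apply: square_ideal_sub; first exact: GL_ideal_gen_stable.
    by apply: GL_ideal_gen_sub; rewrite /= inE eqxx.
  - by apply: GL_ideal_gen_sub; rewrite /= inE hH orbT.
exact: GL_ideal_gen_min.
Qed.
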